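(* Let $I\subseteq[0,1]$ be a subinterval of positive length and let $m\in\mathbb{N}$. For $Q\in\mathbb{N}$ let $A_Q$ be the set of fractions $\frac{a}{q}\in\mathcal{F}(Q)\cap I$ (in lowest terms) with $q\equiv1\bmod m$. Then the repulsion gap of the sequence $(A_Q)_{Q}$ equals $$\frac{3}{\pi^2m\prod_{p\mid m}\left(1-\frac{1}{p^2}\right)},$$ where the product is over the primes $p$ dividing $m$.
   Context: $\mathcal{F}(Q)$ is the set of fractions $\frac{a}{q}\in[0,1]$ with $\gcd(a,q)=1$ and $1\le q\leq Q$. For a finite subset $A=\{x_0\leq x_1\leq\cdots\leq x_N\}$ of $[0,1]$, the gap distribution measure of $A$ is the probability measure $\nu_A$ on $[0,\infty)$ with $$\nu_A[0,\xi]=\frac{1}{N}\#\{j\in[1,N]:N(x_j-x_{j-1})\leq\xi(x_N-x_0)\},\quad \xi\geq0$$ (this makes sense when $A$ has at least two distinct elements). The limiting gap measure of a sequence $\mathcal{A}=(A_n)$ of finite subsets of $[0,1]$ is the weak limit $\nu_{\mathcal{A}}$ of $(\nu_{A_n})$, if it exists; for the sequence in the claim it does exist. For an increasing sequence $\mathcal{A}=(A_n)$ of finite subsets of $[0,1]$ with limiting gap measure $\nu_{\mathcal{A}}$, the repulsion gap of $\mathcal{A}$ is $K_{\mathcal{A}}=\sup\{c\geq0:\nu_{\mathcal{A}}([0,c])=0\}$. *)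

(* Defs.v *)
From HB Require Import structures.
From mathcomp Require Import all_boot all_order all_algebra finmap.
From mathcomp Require Import all_classical all_reals all_analysis.
Import Order.TTheory GRing.Theory Num.Theory.
Import numFieldNormedType.Exports.

Set Implicit Arguments.
Unset Strict Implicit.
Unset Printing Implicit Defensive.

Local Open Scope classical_set_scope.
Local Open Scope ring_scope.

(* Meaningful for finite [A], since [fset_set A] is empty otherwise. *)
Definition points (R : realType) (A : set R) : seq R :=
  sort <=%R (enum_fset (fset_set A)).

Definition nth_point (R : realType) (A : set R) (j : nat) : R := nth 0 (points A) j.

(* [A = {x_0 < ... < x_N}] with [N = gap_number A]. *)
Definition gap_number (R : realType) (A : set R) : nat := (size (points A)).-1.

Definition normalized_gap (R : realType) (A : set R) (j : nat) : R :=
  (gap_number A)%:R * (nth_point A j.+1 - nth_point A j) /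
  (nth_point A (gap_number A) - nth_point A 0).

Lemma gap_weight_ge0 (R : realType) (A : set R) :
  0 <= ((gap_number A)%:R^-1 : R).
Proof. by rewrite invr_ge0. Qed.

(* The uniform probability measure on the [N] normalized gaps, as a measure on
   the line carried by [0, +oo[.  Its values on the intervals [0, xi] are given
   by [gap_measure_itv] below.  It is the zero measure when [A] has fewer than
   two elements. *)
Definition gap_measure (R : realType) (A : set R) :
    {measure set (measurableTypeR R) -> \bar R} :=
  mscale (NngNum (gap_weight_ge0 A))
    (msum (fun j => dirac (normalized_gap A j : measurableTypeR R))
          (gap_number A)).

(* Weak convergence of the gap measures to a probability measure [nu] on
   [0, +oo[, tested against the bounded continuous functions on [0, +oo[. *)
Definition is_limiting_gap_measure (R : realType) (A : nat -> set R)
    (nu : probability (measurableTypeR R) R) : Prop :=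
  nu `[0, +oo[%classic = 1%E /\
  forall f : R -> R,
    {within `[0, +oo[%classic, continuous f} ->
    (exists M : R, forall x, 0 <= x -> `|f x| <= M) ->
    (\int[gap_measure (A n)]_(x in `[0%R, +oo[%classic) (f x)%:E)%E @[n --> \oo] -->
    (\int[nu]_(x in `[0%R, +oo[%classic) (f x)%:E)%E.

Definition repulsion_gap (R : realType)
    (nu : probability (measurableTypeR R) R) : R :=
  sup [set c : R | 0 <= c /\ nu `[0, c]%classic = 0%E].

Definition farey (R : realType) (Q : nat) : set R :=
  [set x | exists a q : nat,
     [/\ (1 <= q <= Q)%N, (a <= q)%N, coprime a q & x = a%:R / q%:R]].

Definition reduced_denominator (R : realType) (x : R) (q : nat) : Prop :=
  exists a : nat, [/\ (0 < q)%N, coprime a q & x = a%:R / q%:R].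

Definition farey_mod1 (R : realType) (I : set R) (m Q : nat) : set R :=
  [set x | [/\ @farey R Q x, I x &
     exists2 q : nat, reduced_denominator x q & q = 1 %[mod m]]].

Lemma finite_farey (R : realType) (Q : nat) : finite_set (@farey R Q).
Proof.
pose s := [seq (p.1%:R / p.2%:R : R) |
  p <- [seq (a, q) | a <- iota 0 Q.+1, q <- iota 0 Q.+1]].
apply: (@sub_finite_set _ _ [set` s]) => [x [a [q [/andP[_ qQ] aq _ ->]]]|].
  apply/mapP; exists (a, q) => //; apply: allpairs_f; rewrite mem_iota ltnS //=.
  exact: leq_trans qQ.
exact: finite_seq.
Qed.

Lemma finite_farey_mod1 (R : realType) (I : set R) (m Q : nat) :
  finite_set (farey_mod1 I m Q).
Proof. by apply: sub_finite_set (finite_farey R Q) => x []. Qed.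

Lemma farey_mod1_increasing (R : realType) (I : set R) (m Q Q' : nat) :
  (Q <= Q')%N -> farey_mod1 I m Q `<=` farey_mod1 I m Q'.
Proof.
move=> QQ' x [[a [q [/andP[q1 qQ] aq cop xE]]] Ix xm]; split=> //.
by exists a, q; split=> //; rewrite q1 (leq_trans qQ).
Qed.

Lemma points_lt (R : realType) (A : set R) (i j : nat) :
  (i < j)%N -> (j < size (points A))%N -> nth_point A i < nth_point A j.
Proof.
move=> ij jN; have : sorted <%R (points A).
  by rewrite lt_sorted_uniq_le sort_uniq fset_uniq sort_le_sorted.
move/(sorted_ltn_nth lt_trans 0); apply => //.
by rewrite inE (ltn_trans ij).
Qed.

Lemma mem_points (R : realType) (A : set R) (x : R) :
  finite_set A -> (x \in points A) = (x \in A).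
Proof. by move=> fA; rewrite mem_sort in_fset_set. Qed.

Lemma gap_measure_itv (R : realType) (A : set R) (xi : R) :
  (0 < gap_number A)%N -> 0 <= xi ->
  gap_measure A `[0, xi]%classic =
  ((gap_number A)%:R^-1 *
   #|[pred j : 'I_(gap_number A) |
      (gap_number A)%:R * (nth_point A j.+1 - nth_point A j) <=
      xi * (nth_point A (gap_number A) - nth_point A 0)]|%:R)%:E.
Proof.
move=> N0 xi0; have sz : (gap_number A < size (points A))%N.
  by move: N0; rewrite /gap_number; case: (size (points A)).
have L0 : 0 < nth_point A (gap_number A) - nth_point A 0.
  by rewrite subr_gt0 points_lt.
rewrite /gap_measure /mscale /= EFinM; congr (_ * _)%E.
rewrite /msum /= -sum1_card natr_sum -sumEFin big_mkcond /=.
apply: eq_bigr => j _.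
rewrite -[LHS]/((\1_(`[0, xi]%classic : set R) (normalized_gap A j))%:E).
rewrite indicE mem_setE in_itv /= inE.
have g0 : 0 <= normalized_gap A j.
  apply: divr_ge0; last exact: ltW.
  apply: mulr_ge0 => //; rewrite subr_ge0 ltW // points_lt //.
  by rewrite (leq_ltn_trans _ sz).
by rewrite g0 /= /normalized_gap ler_pdivrMr //; case: ifP.
Qed.

Lemma gap_measure_setT (R : realType) (A : set R) :
  (0 < gap_number A)%N -> gap_measure A setT = 1%E.
Proof.
move=> N0; rewrite /gap_measure /mscale /= /msum /=.
transitivity ((gap_number A)%:R^-1%:E * \sum_(j < gap_number A) (1%:E : \bar R))%E.
  by congr (_ * _)%E; apply: eq_bigr => j _; exact: diracT.
rewrite sumEFin -EFinM sumr_const card_ord mulVf //.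
by rewrite pnatr_eq0 -lt0n.
Qed.

(* Main.v *)
(** Two fractions with denominators at most [Q] differ by at least [1 / Q ^ 2],
    so the asymptotics [#A_Q ~ K |I| Q ^ 2] bound every normalized gap below by
    [K + o(1)], where [K] is the claimed constant.  To see that [K] is optimal
    without equidistribution of inverses (Kloosterman sums), write the end points
    of a gap as [a / q < (a + b) / (q + d)] with [b q - a d = 1].  Every coprime
    pair [(b, d)] with [b = 1] and [d = 0] modulo [m], [d] at most a small multiple
    of [Q] and [b / d] in [I] arises from some [q] in any window of length [d]
    close to [Q], which gives a positive proportion of gaps of length about
    [1 / Q ^ 2].

    Both counts concern coprime pairs in a residue class modulo [m].  Sorting all
    pairs by their gcd [g] expresses the count of all pairs through the coprime
    counts at [Q / g]; since [sum_(g >= 2) 1 / g ^ 2 < 1], this relation is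
    contracting and determines the coprime asymptotics without Moebius inversion.
    The constant uses [sum 1 / g ^ 2 = pi ^ 2 / 6], obtained from the halving
    identity [1 / sin ^ 2 (x / 2) + 1 / cos ^ 2 (x / 2) = 4 / sin ^ 2 x]. *)

Require Import Defs.
From mathcomp Require Import all_boot all_order all_algebra.
From mathcomp Require Import all_classical all_reals all_analysis.
From mathcomp Require Import measurable_realfun.
From mathcomp Require Import zify ring lra.
Import Order.TTheory GRing.Theory Num.Theory.
Import numFieldNormedType.Exports.

Set Implicit Arguments.
Unset Strict Implicit.
Unset Printing Implicit Defensive.

(** * Counting pairs of naturals *)

Local Open Scope nat_scope.

Definition frac_count (P : rel nat) (Q : nat) : nat :=
  \sum_(1 <= q < Q.+1) \sum_(0 <= a < q.+1) P a q.

Lemma big_multiples (T : Type) (idx : T) (op : Monoid.law idx)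
    (F : nat -> T) (g Q : nat) : 0 < g ->
  (forall n, ~~ (g %| n) -> F n = idx) ->
  \big[op/idx]_(1 <= n < Q.+1) F n = \big[op/idx]_(1 <= n < (Q %/ g).+1) F (g * n).
Proof.
move=> g0 F0; elim: Q => [|Q IH]; first by rewrite div0n !big_nil.
rewrite big_nat_recr //= IH divnS //; case: (boolP (g %| Q.+1)) => gQ.
  rewrite add1n [RHS]big_nat_recr //=; congr (op _ (F _)).
  by rewrite -[LHS](divnK gQ) divnS // gQ mulnC.
by rewrite F0 // Monoid.mulm1.
Qed.

(** Each pair is [g] times a coprime pair, [g] being its gcd, which is positive because [q >= 1];
    the bound [q <= Q] then becomes a bound by the floor of [Q / g]. *)
Lemma frac_count_gcd (P : rel nat) (Q : nat) :
  frac_count P Q = \sum_(1 <= g < Q.+1)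
    frac_count (fun a q => coprime a q && P (g * a) (g * q)) (Q %/ g).
Proof.
rewrite /frac_count.
transitivity (\sum_(1 <= q < Q.+1) \sum_(0 <= a < q.+1)
                \sum_(1 <= g < Q.+1) ((gcdn a q == g) && P a q : nat)).
  apply: eq_big_nat => q /andP[q1 qQ]; apply: eq_big_nat => a _.
  have gI : gcdn a q \in index_iota 1 Q.+1.
    rewrite mem_index_iota gcdn_gt0 q1 orbT /= ltnS.
    by apply: leq_trans (_ : q <= Q) => //; rewrite dvdn_leq ?dvdn_gcdr.
  rewrite (bigD1_seq _ gI) ?iota_uniq //= eqxx big1 ?addn0 //.
  by move=> g; rewrite eq_sym => /negPf ->.
under eq_bigr do rewrite exchange_big_nat /=.
rewrite exchange_big_nat /=; apply: eq_big_nat => g /andP[g0 _].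
rewrite (@big_multiples _ _ _ _ g) //; last first.
  move=> q gq; rewrite big1 // => a _; case: eqP => // E.
  by move: gq; rewrite -E dvdn_gcdr.
apply: eq_bigr => q _.
(* The term [a = 0] is split off because [big_multiples] starts at 1; there both gcd conditions say
   [q = 1]. *)
rewrite [LHS]big_ltn // [RHS]big_ltn //; congr (_ + _).
  rewrite gcd0n /coprime gcd0n muln0; congr (nat_of_bool (_ && _)).
  by apply/eqP/eqP; nia.
rewrite (@big_multiples _ _ _ _ g) //; last first.
  move=> a ga; case: eqP => // E.
  by move: ga; rewrite -E dvdn_gcdl.
rewrite mulKn //; apply: eq_bigr => a _.
rewrite -muln_gcdr /coprime; congr (nat_of_bool (_ && _)).
by apply/eqP/eqP; nia.
Qed.

Lemma leq_frac_count (P P' : rel nat) (Q : nat) :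
  (forall a q, 0 < q <= Q -> a <= q -> P a q -> P' a q) ->
  frac_count P Q <= frac_count P' Q.
Proof.
move=> PP'; rewrite /frac_count big_nat [leqRHS]big_nat.
apply: leq_sum => q qQ; rewrite big_nat [leqRHS]big_nat.
apply: leq_sum => a aq; move: (PP' a q qQ aq).
by case: (P a q) => // ->.
Qed.

Lemma eq_frac_count (P P' : rel nat) (Q : nat) :
  (forall a q, 0 < q <= Q -> a <= q -> P a q = P' a q) ->
  frac_count P Q = frac_count P' Q.
Proof.
move=> PP'; apply/eqP; rewrite eqn_leq.
by apply/andP; split; apply: leq_frac_count => a q qQ aq; rewrite PP'.
Qed.

Lemma frac_count_le (P : rel nat) (Q : nat) : frac_count P Q <= Q * Q.+1.
Proof.
rewrite /frac_count big_nat.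
apply: (@leq_trans (\sum_(1 <= q < Q.+1) Q.+1)).
  rewrite [leqRHS]big_nat; apply: leq_sum => q /andP[_ qQ].
  apply: (@leq_trans (\sum_(0 <= a < q.+1) 1)); first by apply: leq_sum => a _; case: P.
  by rewrite sum_nat_const_nat muln1 subn0.
by rewrite sum_nat_const_nat subSS subn0.
Qed.

Definition frac_seq (P : rel nat) (Q : nat) : seq (nat * nat) :=
  [seq p <- [seq (a, q) | q <- index_iota 1 Q.+1, a <- index_iota 0 q.+1] |
     P p.1 p.2].

Lemma size_frac_seq (P : rel nat) (Q : nat) :
  size (frac_seq P Q) = frac_count P Q.
Proof.
rewrite size_filter count_flatten -map_comp sumnE big_map /frac_count.
apply: eq_bigr => q _; rewrite [LHS]count_map -size_filter.
by rewrite -sum1_size big_filter big_mkcond; apply: eq_bigr => a _ /=; case: P.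
Qed.

Lemma frac_seq_uniq (P : rel nat) (Q : nat) : uniq (frac_seq P Q).
Proof.
apply: filter_uniq; apply: allpairs_uniq_dep => [|q _|[q a] [q' a'] _ _ /= [-> ->]] //;
  exact: iota_uniq.
Qed.

Lemma mem_frac_seq (P : rel nat) (Q a q : nat) :
  ((a, q) \in frac_seq P Q) = [&& P a q, 0 < q <= Q & a <= q].
Proof.
rewrite mem_filter; congr (_ && _); apply/idP/idP.
  case/allpairsPdep => q' [a' []]; rewrite !mem_index_iota => qQ aq [-> ->].
  by move: qQ aq; lia.
move=> aqQ; apply/allpairsPdep; exists q, a.
by rewrite !mem_index_iota; split => //; lia.
Qed.

Definition class_count (s m n : nat) : nat := \sum_(0 <= a < n) (a == s %[mod m]).

Lemma class_count_bounds (s m n : nat) : 0 < m ->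
  m * class_count s m n <= n + m /\ n <= m * class_count s m n + m.
Proof.
move=> m0; have sm : s %% m < m by rewrite ltn_mod.
(* With [t = s %% m], the count is the ceiling of [(n - t) / m], written with the shift [m - 1 - t]
   so that it makes sense in the naturals for all [n]. *)
suff -> : class_count s m n = (n + (m - (s %% m).+1)) %/ m.
  have := divn_eq (n + (m - (s %% m).+1)) m.
  have := ltn_pmod (n + (m - (s %% m).+1)) m0.
  by move: (_ %% m) (_ %/ m) => *; split; nia.
elim: n => [|n IH]; first by rewrite /class_count big_nil divn_small //; lia.
rewrite /class_count big_nat_recr //= -/(class_count s m n) IH addSn divnS //.
rewrite addnC; congr (nat_of_bool _ + _); rewrite -[in LHS](modn_mod s).
rewrite -(eqn_modDr (m - s %% m)) subnKC ?modnn 1?ltnW // -/(dvdn _ _).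
by congr (_ %| _); lia.
Qed.

(** Abel summation: it reduces the sum of the [q] in a residue class to plain counts, which are
    known up to an error 1. The form is additive to avoid truncated subtraction. *)
Lemma class_sum_abel (r m Q : nat) :
  \sum_(1 <= q < Q.+1) q * (q == r %[mod m]) + \sum_(1 <= j < Q.+1) class_count r m j =
  Q * class_count r m Q.+1.
Proof.
elim: Q => [|Q IH]; first by rewrite !big_nil.
rewrite !(big_nat_recr Q.+1) //= addnACA IH.
by rewrite /class_count (big_nat_recr Q.+1) //=; nia.
Qed.

Local Open Scope classical_set_scope.
Local Open Scope ring_scope.

(** * Lattice points in a sector *)

Lemma class_count_dist (R : realType) (s m n : nat) : (0 < m)%N ->
  `|(class_count s m n)%:R - n%:R / m%:R| <= 1 :> R.
Proof.
move=> m0; have [h1 h2] := class_count_bounds s n m0.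
have m0R : 0 < m%:R :> R by rewrite ltr0n.
have h1' : m%:R * (class_count s m n)%:R <= n%:R + m%:R :> R.
  by rewrite -natrM -natrD ler_nat.
have h2' : n%:R <= m%:R * (class_count s m n)%:R + m%:R :> R.
  by rewrite -natrM -natrD ler_nat.
rewrite -(ler_pM2l m0R) -{1}(gtr0_norm m0R) -normrM mulr1 mulrBr.
rewrite [m%:R * (_ / _)]mulrC divfK ?gt_eqF // ler_norml; apply/andP; split; lra.
Qed.

(** The lower bound is stated for [a < y] and the upper bound for [a <= y], hence each also holds
    for the other cutoff; an end point may be counted or not. *)
Lemma class_count_cutoff (R : realType) (s m q : nat) (y : R) :
  (0 < m)%N -> 0 <= y <= q%:R ->
  y / m%:R - 2 <= (\sum_(0 <= a < q.+1) ((a%:R < y)%R && (a == s %[mod m])))%:R /\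
  (\sum_(0 <= a < q.+1) ((a%:R <= y)%R && (a == s %[mod m])))%:R <= y / m%:R + 2.
Proof.
move=> m0 /andP[y0 yq].
have m1 : m%:R^-1 <= 1 :> R by rewrite invf_le1 ?ler1n // ltr0n.
have mi0 : 0 <= m%:R^-1 :> R by rewrite invr_ge0.
have /andP[ny yn] := truncn_itv y0; set n := Num.truncn y in ny yn.
have nq : (n <= q)%N by rewrite -(ler_nat R) (le_trans ny).
have cE k : (k <= q.+1)%N ->
    class_count s m k = (\sum_(0 <= a < q.+1) ((a < k)%N && (a == s %[mod m])))%N.
  move=> kq; rewrite /class_count (big_nat_widen _ _ _ _ _ kq) big_mkcond /=.
  by apply: eq_bigr => a _; case: ltnP.
split.
  have := class_count_dist R s n m0; rewrite ler_norml => /andP[h _].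
  apply: (@le_trans _ _ (class_count s m n)%:R).
    have : y * m%:R^-1 <= (n%:R + 1) * m%:R^-1 by rewrite ler_wpM2r // ltW // natr1.
    by lra.
  rewrite (cE _ (leqW nq)) ler_nat; apply: leq_sum => a _.
  case: ltnP => //= an; suff -> : a%:R < y by [].
  by rewrite (lt_le_trans _ ny) // ltr_nat.
have := class_count_dist R s n.+1 m0; rewrite ler_norml => /andP[_ h].
apply: (@le_trans _ _ (class_count s m n.+1)%:R); last first.
  have : (n%:R + 1) * m%:R^-1 <= (y + 1) * m%:R^-1 by rewrite ler_wpM2r // lerD2r.
  by move: h; rewrite -natr1; lra.
rewrite (cE n.+1 _) // ler_nat; apply: leq_sum => a _.
case: (boolP (a%:R <= y)) => //= ay; suff -> : (a < n.+1)%N by [].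
by rewrite -(ltr_nat R) (le_lt_trans ay).
Qed.

(** Only the end points of [J] are undetermined, so its count lies between two differences of cutoff
    counts at [q * beta] and [q * alpha]. Each cutoff is off by at most 2, whence 4. *)
Lemma class_count_itv (R : realType) (J : pred R) (alpha beta : R) (s m q : nat) :
  0 <= alpha -> alpha <= beta -> beta <= 1 ->
  (forall x, J x -> alpha <= x <= beta) -> (forall x, alpha < x < beta -> J x) ->
  (0 < m)%N -> (0 < q)%N ->
  `|(\sum_(0 <= a < q.+1) (J (a%:R / q%:R)%R && (a == s %[mod m])))%:R -
    q%:R * (beta - alpha) / m%:R| <= 4.
Proof.
move=> a0 ab b1 Jsub subJ m0 q0; have q0R : 0 < q%:R :> R by rewrite ltr0n.
have xq (a : nat) (x : R) : (x <= a%:R / q%:R) = (q%:R * x <= a%:R).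
  by rewrite ler_pdivlMr // mulrC.
have qx (a : nat) (x : R) : (a%:R / q%:R <= x) = (a%:R <= q%:R * x).
  by rewrite ler_pdivrMr // mulrC.
have hq (x : R) : 0 <= x <= 1 -> 0 <= q%:R * x <= q%:R.
  by move=> /andP[x0 x1]; rewrite mulr_ge0 ?ler_piMr // ltW.
have [la ua] := @class_count_cutoff R s m q (q%:R * alpha) m0 (hq alpha ltac:(lra)).
have [lb ub] := @class_count_cutoff R s m q (q%:R * beta) m0 (hq beta ltac:(lra)).
set S := \sum_(_ <= _ < _) _.
have up : S%:R + (\sum_(0 <= a < q.+1) ((a%:R < q%:R * alpha)%R && (a == s %[mod m])))%:R
    <= (\sum_(0 <= a < q.+1) ((a%:R <= q%:R * beta)%R && (a == s %[mod m])))%:R :> R.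
  rewrite -natrD ler_nat -big_split /=; apply: leq_sum => a _.
  case: (a == s %[mod m]); rewrite ?andbF ?andbT //=.
  case: (boolP (J _)) => [/Jsub|_].
    by rewrite xq qx ltNge => /andP[-> ->].
  case: ltP => //= h; rewrite (le_trans (ltW h)) //.
  by rewrite ler_pM2l.
have dn : (\sum_(0 <= a < q.+1) ((a%:R < q%:R * beta)%R && (a == s %[mod m])))%:R
    <= S%:R + (\sum_(0 <= a < q.+1) ((a%:R <= q%:R * alpha)%R && (a == s %[mod m])))%:R :> R.
  rewrite -natrD ler_nat -big_split /=; apply: leq_sum => a _.
  case: (a == s %[mod m]); rewrite ?andbF ?andbT //=.
  case: (leP a%:R (q%:R * alpha)) => [_|h1]; first by rewrite addn1; case: (a%:R < _).
  case: (ltP a%:R (q%:R * beta)) => [h2|_] //; rewrite subJ //.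
  by rewrite !ltNge xq qx -!ltNge h1 h2.
have E : q%:R * (beta - alpha) / m%:R = q%:R * beta / m%:R - q%:R * alpha / m%:R.
  by rewrite -mulrBl -mulrBr.
rewrite E ler_norml; apply/andP; split; lra.
Qed.

Lemma class_sum_dist (R : realType) (r m Q : nat) : (0 < m)%N ->
  `|(\sum_(1 <= q < Q.+1) q * (q == r %[mod m]))%:R - Q%:R ^+ 2 / (2 * m%:R)|
    <= 3 * Q%:R :> R.
Proof.
move=> m0; have m0R : 0 < m%:R :> R by rewrite ltr0n.
have mi1 : m%:R^-1 <= 1 :> R by rewrite invf_le1 ?ler1n.
have mi0 : 0 <= m%:R^-1 :> R by rewrite invr_ge0.
have := class_sum_abel r m Q; move/(congr1 (fun n : nat => n%:R : R)).
rewrite natrD natrM; set W := (\sum_(1 <= q < _) _)%:R => E.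
have S1 : `|(\sum_(1 <= j < Q.+1) class_count r m j)%:R
            - (Q%:R * (Q%:R + 1) / 2) / m%:R| <= Q%:R :> R.
  elim: Q {W E} => [|Q IH]; first by rewrite big_nil mul0r mul0r mul0r subr0 normr0.
  rewrite big_nat_recr //= natrD.
  have := class_count_dist R r Q.+1 m0; move: IH; move: (\sum_(_ <= _ < _) _)%:R => x.
  rewrite -!(natr1 Q); move: (class_count _ _ _)%:R => y h1 h2.
  have -> : x + y - (Q%:R + 1) * (Q%:R + 1 + 1) / 2 / m%:R =
     (x - (Q%:R * (Q%:R + 1) / 2) / m%:R) + (y - (Q%:R + 1) / m%:R) by field; rewrite pnatr_eq0; lia.
  by rewrite (le_trans (ler_normD _ _)) // lerD.
have S2 : `|Q%:R * (class_count r m Q.+1)%:R - Q%:R * ((Q%:R + 1) / m%:R)| <= Q%:R :> R.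
  rewrite -mulrBr normrM normr_nat; have := class_count_dist R r Q.+1 m0.
  by rewrite -natr1 => h; rewrite ler_piMr.
have S3 : 0 <= Q%:R / m%:R :> R by exact: mulr_ge0.
have S4 : Q%:R / m%:R <= Q%:R :> R by exact: ler_piMr.
(* The main terms of [S2] and [S1] combine to [Q (Q + 1) / (2 m)]; its linear part joins their two
   errors [Q] within [3 Q]. *)
have -> : Q%:R ^+ 2 / (2 * m%:R) = Q%:R * ((Q%:R + 1) / m%:R)
   - (Q%:R * (Q%:R + 1) / 2) / m%:R - (Q%:R * m%:R^-1) / 2 :> R.
  by field; rewrite pnatr_eq0; lia.
move: S1 S2 S3 S4 E; rewrite !ler_norml.
move: (Q%:R * (class_count r m Q.+1)%:R) (\sum_(_ <= _ < _) class_count _ _ _)%:R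
  (Q%:R * ((Q%:R + 1) / m%:R)) (Q%:R * (Q%:R + 1) / 2 / m%:R) (Q%:R / m%:R).
by move=> x1 x2 x3 x4 x5 /andP[? ?] /andP[? ?] ? ? ?; apply/andP; split; lra.
Qed.

Definition class_rel (R : realType) (J : pred R) (m s r : nat) : rel nat :=
  fun a q => [&& J (a%:R / q%:R), a == s %[mod m] & q == r %[mod m]].

(** Summing over the rows [q] in the class of [r]: the rows cost [4 Q] in all, and [class_sum_dist],
    scaled by [(beta - alpha) / m <= 1], costs [3 Q]. *)
Lemma class_rel_count (R : realType) (J : pred R) (alpha beta : R) (m s r Q : nat) :
  0 <= alpha -> alpha <= beta -> beta <= 1 ->
  (forall x, J x -> alpha <= x <= beta) -> (forall x, alpha < x < beta -> J x) ->
  (0 < m)%N ->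
  `|(frac_count (class_rel J m s r) Q)%:R -
    (beta - alpha) / (2 * m%:R ^+ 2) * Q%:R ^+ 2| <= 7 * Q%:R.
Proof.
move=> a0 ab b1 Jsub subJ m0; have m0R : 0 < m%:R :> R by rewrite ltr0n.
have h1 : `|(frac_count (class_rel J m s r) Q)%:R -
    (\sum_(1 <= q < Q.+1) q * (q == r %[mod m]))%:R * ((beta - alpha) / m%:R)| <= 4 * Q%:R.
  rewrite /frac_count !natr_sum big_distrl /= -sumrB.
  apply: le_trans (ler_norm_sum _ _ _) _.
  have -> : 4 * Q%:R = \sum_(1 <= q < Q.+1) 4 :> R.
    by rewrite sumr_const_nat subSS subn0 mulr_natr.
  rewrite big_nat [leRHS]big_nat; apply: ler_sum => q /andP[q0 _].
  rewrite /class_rel; case: (q == r %[mod m]); last first.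
    rewrite muln0 mul0r subr0 big1 ?normr0 // => a _; by rewrite !andbF.
  rewrite muln1 mulrA; under eq_bigr do rewrite andbT.
  exact: class_count_itv.
have L1 : 0 <= (beta - alpha) / m%:R <= 1.
  rewrite divr_ge0 ?subr_ge0 //= ler_pdivrMr // mul1r.
  have : 1 <= m%:R :> R by rewrite ler1n.
  by lra.
have h2 := class_sum_dist R r Q m0.
have -> : (beta - alpha) / (2 * m%:R ^+ 2) * Q%:R ^+ 2 =
   (Q%:R ^+ 2 / (2 * m%:R)) * ((beta - alpha) / m%:R).
  by field; rewrite pnatr_eq0; lia.
move: h1 h2 L1; move: (frac_count _ _)%:R (\sum_(_ <= _ < _) _)%:R.
move: ((beta - alpha) / m%:R) (Q%:R ^+ 2 / (2 * m%:R)) => l z x y h1 h2 /andP[l0 l1].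
have -> : x - z * l = (x - y * l) + (y - z) * l by ring.
apply: le_trans (ler_normD _ _) _; rewrite normrM (ger0_norm l0).
have : `|y - z| * l <= `|y - z| by rewrite ler_piMr.
by lra.
Qed.

(** * Coprime pairs in residue classes *)

(** This is [o(Q ^ 2)], with an additive constant in place of a threshold: the bound then holds at
    every [Q], the shape needed when counts are evaluated at all [Q / g]. *)
Definition quad_small (R : realType) (f : nat -> R) :=
  forall eta : R, 0 < eta -> exists B : R, forall Q, `|f Q| <= eta * Q%:R ^+ 2 + B.

Lemma quad_small_le (R : realType) (f g : nat -> R) :
  (forall Q, `|f Q| <= `|g Q|) -> quad_small g -> quad_small f.
Proof.
move=> fg sg eta /sg[B HB]; exists B => Q; exact: le_trans (fg Q) (HB Q).
Qed.

Lemma quad_smallD (R : realType) (f g : nat -> R) :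
  quad_small f -> quad_small g -> quad_small (fun Q => f Q + g Q).
Proof.
move=> sf sg eta eta0; have eta2 : 0 < eta / 2 by lra.
have [B HB] := sf _ eta2; have [B' HB'] := sg _ eta2.
exists (B + B') => Q; apply: le_trans (ler_normD _ _) _.
by have := HB Q; have := HB' Q; lra.
Qed.

Lemma quad_smallZ (R : realType) (c : R) (f : nat -> R) :
  quad_small f -> quad_small (fun Q => c * f Q).
Proof.
move=> sf eta eta0; have c0 : 0 < `|c| + 1 by rewrite ltr_wpDl.
have [B HB] := sf _ (divr_gt0 eta0 c0).
exists ((`|c| + 1) * `|B|) => Q; rewrite normrM.
have h : `|f Q| <= eta / (`|c| + 1) * Q%:R ^+ 2 + `|B|.
  by apply: le_trans (HB Q) _; rewrite lerD2l ler_norm.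
apply: (@le_trans _ _ ((`|c| + 1) * `|f Q|)).
  by rewrite ler_wpM2r // lerDl.
apply: le_trans (ler_wpM2l (ltW c0) h) _.
by rewrite mulrDr !mulrA [_ * eta]mulrC -[eta * _ / _]mulrA divff ?mulr1 // gt_eqF.
Qed.

Lemma quad_small_linear (R : realType) : quad_small (fun Q => Q%:R : R).
Proof.
move=> eta eta0; exists (eta^-1) => Q; rewrite normr_nat.
(* Expanding this square bounds [2 Q] by [eta Q ^ 2 + 1 / eta]. *)
have : 0 <= eta * (Q%:R - eta^-1) ^+ 2 by rewrite mulr_ge0 ?sqr_ge0 // ltW.
have -> : eta * (Q%:R - eta^-1) ^+ 2 = eta * Q%:R ^+ 2 - 2 * Q%:R + eta^-1.
  by field; rewrite gt_eqF.
have : 0 <= Q%:R :> R by [].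
by lra.
Qed.

(** What matters is a bound below 1: it makes the recursion over gcds in [coprime_count_asymp]
    contracting. *)
Lemma sum_inv_sqr_le (R : realType) (Q : nat) :
  \sum_(2 <= g < Q.+1) (g%:R ^+ 2)^-1 <= 3 / 4 :> R.
Proof.
case: Q => [|[|Q]]; [by rewrite big_geq //; lra | by rewrite big_geq //; lra |].
(* The bound is strengthened to make it inductive: [1 / g ^ 2 <= 1 / (g - 1) - 1 / g] telescopes
   from [g = 3] on, and the term [g = 2] gives equality. *)
suff : \sum_(2 <= g < Q.+3) (g%:R ^+ 2)^-1 <= 3 / 4 - (Q%:R + 2)^-1 :> R.
  by move=> /le_trans; apply; rewrite gerBl invr_ge0 addr_ge0.
elim: Q => [|Q IH]; first by rewrite big_nat1 add0r; lra.
rewrite big_nat_recr //=; apply: le_trans (lerD IH (lexx _)) _.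
have -> : Q.+3%:R = Q%:R + 3 :> R by rewrite -addn3 natrD.
have -> : Q.+1%:R = Q%:R + 1 :> R by rewrite -addn1 natrD.
have Q0 : 0 <= Q%:R :> R by [].
rewrite -addrA lerD2l -[Q%:R + 1 + 2]addrA; have -> : 1 + 2 = 3 :> R by lra.
rewrite -subr_ge0.
have -> : - (Q%:R + 3)^-1 - (- (Q%:R + 2)^-1 + ((Q%:R + 3) ^+ 2)^-1) =
   ((Q%:R + 2) * (Q%:R + 3) ^+ 2)^-1 :> R.
  by field; apply/andP; split; lra.
by rewrite invr_ge0 mulr_ge0 ?sqr_ge0 // addr_ge0.
Qed.

(** * Sorting the pairs of a residue class by their gcd *)

Definition coprime_count (R : realType) (J : pred R) (m s r Q : nat) : nat :=
  frac_count (fun a q => coprime a q && class_rel J m s r a q) Q.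

(** For [g] coprime to [m], the Chinese remainder of 1 modulo [m] and 0 modulo [g] is a multiple of
    [g]; dividing it by [g] leaves an inverse of [g] modulo [m]. *)
Definition inv_mod (m g : nat) : nat := (chinese m g 1 0 %/ g)%N.

Lemma inv_modP (m g : nat) : coprime g m -> (g * inv_mod m g = 1 %[mod m])%N.
Proof.
rewrite coprime_sym => cgm; rewrite /inv_mod mulnC divnK ?chinese_modl //.
by rewrite /dvdn (chinese_modr cgm) mod0n.
Qed.

Lemma coprime_inv_mod (m g : nat) : coprime g m -> coprime (inv_mod m g) m.
Proof.
move=> /inv_modP gh; have : coprime (g * inv_mod m g) m.
  by rewrite -coprime_modl gh coprime_modl coprime1n.
by rewrite coprimeMl => /andP[].
Qed.

Lemma eq_mod_inv (m g a s : nat) : coprime g m ->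
  (g * a == s %[mod m])%N = (a == inv_mod m g * s %[mod m])%N.
Proof.
move=> /inv_modP gh; apply/eqP/eqP => h.
  by rewrite -[RHS]modnMmr -h modnMmr mulnA [(inv_mod _ _ * _)%N]mulnC -modnMml gh modnMml mul1n.
rewrite -modnMmr h modnMmr mulnA -modnMml gh modnMml.
by rewrite mul1n.
Qed.

Lemma class_relZ (R : realType) (J : pred R) (m s r g a q : nat) :
  (0 < g)%N -> coprime g m ->
  class_rel J m s r (g * a)%N (g * q)%N =
  class_rel J m (inv_mod m g * s)%N (inv_mod m g * r)%N a q.
Proof.
move=> g0 gm; rewrite /class_rel !eq_mod_inv // !natrM -mulf_div divff ?mul1r //.
by rewrite pnatr_eq0 -lt0n.
Qed.

(** A common factor of [m] and the gcd of a pair divides both [s] and [r], so the hypothesis forces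
    the gcd to be coprime to [m]. Division by such a [g] keeps the fraction and multiplies both
    classes by the inverse of [g]. *)
Lemma class_count_gcd (R : realType) (J : pred R) (m s r Q : nat) :
  coprime (gcdn s r) m ->
  frac_count (class_rel J m s r) Q = (\sum_(1 <= g < Q.+1 | coprime g m)
    coprime_count J m (inv_mod m g * s)%N (inv_mod m g * r)%N (Q %/ g))%N.
Proof.
move=> srm; rewrite frac_count_gcd [RHS]big_mkcond /=.
apply: eq_big_nat => g /andP[g0 _]; case: ifP => gm.
  by apply: eq_frac_count => a q _ _; rewrite class_relZ.
rewrite /frac_count big1 // => q _; rewrite big1 // => a _.
case: coprime => //=; rewrite /class_rel.
case: (J _) => //=; case: eqP => //= Es; case: eqP => //= Er.
case/negP: (negbT gm); rewrite /coprime -dvdn1 -(eqP srm) !dvdn_gcd dvdn_gcdr andbT.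
have kx x y : (g * x = y %[mod m])%N -> (gcdn g m %| y)%N.
  move=> E; have : (gcdn g m %| y %% m)%N.
    rewrite -E /dvdn modn_dvdm ?dvdn_gcdr // -/(dvdn _ _).
    by rewrite dvdn_mulr ?dvdn_gcdl.
  by rewrite /dvdn modn_dvdm ?dvdn_gcdr.
by rewrite (kx _ _ Es) (kx _ _ Er).
Qed.

Definition inv_sqr_sum (R : realType) (P : pred nat) (Q : nat) : R :=
  \sum_(1 <= g < Q.+1 | P g) (g%:R ^+ 2)^-1.

(** Dropping the floor changes a term by at most [2 x] with [x = Q / g], and
    [2 x <= (eta / 4) x ^ 2 + 4 / eta]. The squares sum to a multiple of [eta Q ^ 2] and the
    constants to [4 Q / eta], so no harmonic sum appears. *)
Lemma sum_floor_sqr (R : realType) (m : nat) (Z : R) :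
  quad_small (fun Q => (inv_sqr_sum R (coprime^~ m) Q - Z) * Q%:R ^+ 2) ->
  quad_small (fun Q => \sum_(1 <= g < Q.+1 | coprime g m) (Q %/ g)%:R ^+ 2 - Z * Q%:R ^+ 2).
Proof.
move=> HZ.
have F : quad_small (fun Q => \sum_(1 <= g < Q.+1 | coprime g m) (Q %/ g)%:R ^+ 2 -
     inv_sqr_sum R (coprime^~ m) Q * Q%:R ^+ 2); last first.
  have := quad_smallD F HZ; apply: quad_small_le => Q; rewrite le_eqVlt; apply/orP; left.
  by apply/eqP; congr (`| _ |); ring.
move=> eta eta0.
have e4 : 0 < eta / 4 by lra.
(* The precision [(eta / 4) ^ 2] is chosen so that [4 Q / eta] stays below [(eta / 4) Q ^ 2] plus a
   constant. *)
have [B HB] := quad_small_linear (mulr_gt0 e4 e4).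
exists ((eta / 4)^-1 * B) => Q.
rewrite /inv_sqr_sum big_distrl /= -sumrB big_mkcond /=.
apply: le_trans (ler_norm_sum _ _ _) _.
apply: (@le_trans _ _ (\sum_(1 <= g < Q.+1)
   ((eta / 4) * Q%:R ^+ 2 * (g%:R ^+ 2)^-1 + (eta / 4)^-1))).
  rewrite big_nat [leRHS]big_nat; apply: ler_sum => g /andP[g0 _].
  have rhs0 : 0 <= eta / 4 * Q%:R ^+ 2 / g%:R ^+ 2 + (eta / 4)^-1.
    by rewrite addr_ge0 ?invr_ge0 ?(ltW e4) // divr_ge0 ?sqr_ge0 // mulr_ge0 ?sqr_ge0 ?(ltW e4).
  case: ifP => _; last by rewrite normr0.
  have g0R : 0 < g%:R :> R by rewrite ltr0n.
  set x := Q%:R / g%:R : R.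
  have E1 : Q%:R ^+ 2 / g%:R ^+ 2 = x ^+ 2 by rewrite /x expr_div_n.
  rewrite [(g%:R ^+ 2)^-1 * _]mulrC -mulrA E1.
  have lo : (Q %/ g)%:R <= x :> R by rewrite /x ler_pdivlMr // -natrM ler_nat leq_divM.
  have hi : x < (Q %/ g)%:R + 1.
    by rewrite /x ltr_pdivrMr // natr1 -natrM ltr_nat ltn_ceil.
  have y0 : 0 <= (Q %/ g)%:R :> R by [].
  have am : 2 * x <= eta / 4 * x ^+ 2 + (eta / 4)^-1.
    rewrite -subr_ge0; have -> : eta / 4 * x ^+ 2 + (eta / 4)^-1 - 2 * x =
      eta / 4 * (x - (eta / 4)^-1) ^+ 2 by field; rewrite gt_eqF.
    by rewrite mulr_ge0 ?sqr_ge0 // ltW.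
  have := subr_ge0 ((Q %/ g)%:R) x; rewrite lo => d0.
  rewrite distrC ger0_norm; last by rewrite subr_ge0 ler_sqr ?nnegrE // (le_trans y0).
  apply: le_trans am; rewrite subr_sqr.
  have : (x - (Q %/ g)%:R) * (x + (Q %/ g)%:R) <= 1 * (x + (Q %/ g)%:R).
    by rewrite ler_wpM2r ?addr_ge0 // ?(le_trans y0) //; lra.
  by lra.
rewrite big_split /= -mulr_sumr sumr_const_nat subSS subn0.
have S : \sum_(1 <= g < Q.+1) (g%:R ^+ 2)^-1 <= 2 :> R.
  case: (Q) => [|n]; first by rewrite big_nil.
  by rewrite big_ltn // expr1n invr1; have := sum_inv_sqr_le R n.+1; lra.
have E2 : (eta / 4)^-1 *+ Q <= eta / 4 * Q%:R ^+ 2 + (eta / 4)^-1 * B.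
  rewrite -[leLHS]mulr_natr; have := HB Q; rewrite normr_nat => h.
  have i0 : 0 <= (eta / 4)^-1 by rewrite invr_ge0 ltW.
  apply: le_trans (ler_wpM2l i0 h) _; move: (gt_eqF e4).
  by move: (eta / 4) => t t0; rewrite mulrDr !mulrA mulVf ?t0 ?mul1r.
have E3 : eta / 4 * Q%:R ^+ 2 * (\sum_(1 <= g < Q.+1) (g%:R ^+ 2)^-1) <= eta / 4 * Q%:R ^+ 2 * 2.
  by rewrite ler_wpM2l // mulr_ge0 ?sqr_ge0 // ltW.
have : 0 <= eta / 4 * Q%:R ^+ 2 by rewrite mulr_ge0 ?sqr_ge0 // ltW.
lra.
Qed.

(** By [class_count_gcd], the errors [e] at [Q / g] sum to [o(Q ^ 2)] over [g] coprime to [m].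
    Isolating [g = 1] turns a bound [A Q ^ 2 + B] into one with a smaller [A], and iterating brings
    [A] below [delta]. The bounds are uniform in [s] and [r] because the classes change with [g]. *)
Lemma coprime_count_asymp (R : realType) (J : pred R) (alpha beta : R) (m : nat) (Z : R) :
  0 <= alpha -> alpha <= beta -> beta <= 1 ->
  (forall x, J x -> alpha <= x <= beta) -> (forall x, alpha < x < beta -> J x) ->
  (0 < m)%N -> 0 < Z ->
  quad_small (fun Q => (inv_sqr_sum R (coprime^~ m) Q - Z) * Q%:R ^+ 2) ->
  forall delta : R, 0 < delta -> exists B : R, forall s r Q, coprime (gcdn s r) m ->
    `|(coprime_count J m s r Q)%:R - (beta - alpha) / (2 * m%:R ^+ 2 * Z) * Q%:R ^+ 2|
      <= delta * Q%:R ^+ 2 + B.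
Proof.
move=> a0 ab b1 Jsub subJ m0 Z0 HZ.
have m0R : 0 < m%:R :> R by rewrite ltr0n.
set l := _ / (2 * _ * Z).
have l0 : 0 <= l by rewrite divr_ge0 ?subr_ge0 // !mulr_ge0 ?sqr_ge0 // ltW.
pose e s r Q : R := (coprime_count J m s r Q)%:R - l * Q%:R ^+ 2.
have [F [F0 sF HF]] : exists F : nat -> R, [/\ forall Q, 0 <= F Q, quad_small F &
    forall s r Q, coprime (gcdn s r) m ->
    `|\sum_(1 <= g < Q.+1 | coprime g m) e (inv_mod m g * s)%N (inv_mod m g * r)%N (Q %/ g)%N|
      <= F Q].
  exists (fun Q => 7 * Q%:R + l *
    `|\sum_(1 <= g < Q.+1 | coprime g m) (Q %/ g)%:R ^+ 2 - Z * Q%:R ^+ 2|).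
  split=> [Q||s r Q srm].
  - by rewrite addr_ge0 // mulr_ge0.
  - apply: quad_smallD; apply: quad_smallZ; first exact: quad_small_linear.
    by apply: quad_small_le (sum_floor_sqr HZ) => Q; rewrite normr_id.
  - rewrite sumrB -natr_sum -class_count_gcd // -mulr_sumr.
    have := @class_rel_count R J alpha beta m s r Q a0 ab b1 Jsub subJ m0.
    move: (frac_count _ _)%:R (\sum_(_ <= _ < _ | _) _) => x y h.
    have -> : x - l * y = (x - (beta - alpha) / (2 * m%:R ^+ 2) * Q%:R ^+ 2)
       - l * (y - Z * Q%:R ^+ 2).
      by rewrite /l; field; rewrite !gt_eqF.
    apply: le_trans (ler_normB _ _) _.
    by rewrite normrM (ger0_norm l0) lerD2r.
pose P A := exists B : R, 0 <= B /\ forall s r Q, coprime (gcdn s r) m ->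
  `|e s r Q| <= A * Q%:R ^+ 2 + B.
(* The inverse of 1 is used only up to congruence, which suffices to identify the term [g = 1] with
   [e s r Q]. *)
have e1 s r Q : e (inv_mod m 1 * s)%N (inv_mod m 1 * r)%N Q = e s r Q.
  rewrite /e; congr (_%:R - _); apply: eq_frac_count => a q _ _.
  by rewrite -(@class_relZ _ J m s r 1%N) ?coprime1n ?mul1n.
(* The terms [g >= 2] contribute at most [3 / 4 * A], by [sum_inv_sqr_le]; the
   remaining errors are absorbed in [A / 8]. *)
have step A : 0 < A -> P A -> P (7 / 8 * A).
  move=> A0 [B [B0 HB]]; have A16 : 0 < A / 16 by lra.
  have [B1 HB1] := sF _ A16.
  have [B2 HB2] := quad_smallZ B (@quad_small_linear R) A16.
  exists (`|B1| + `|B2|); split; first by rewrite addr_ge0.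
  move=> s r Q srm; case: Q => [|Q].
    rewrite /e /coprime_count /frac_count big_geq // expr0n /= !mulr0 subr0 normr0 add0r.
    exact: addr_ge0.
  have := HF s r Q.+1 srm; rewrite big_ltn_cond //= coprime1n e1 divn1.
  set S := \sum_(_ <= _ < _ | _) _ => HF1.
  have HS : `|S| <= 3 / 4 * A * Q.+1%:R ^+ 2 + B * Q.+1%:R.
    rewrite /S big_mkcond /=; apply: le_trans (ler_norm_sum _ _ _) _.
    apply: (@le_trans _ _ (\sum_(2 <= g < Q.+2) (A * Q.+1%:R ^+ 2 * (g%:R ^+ 2)^-1 + B))).
      rewrite big_nat [leRHS]big_nat; apply: ler_sum => g /andP[g2 _].
      have g0 : (0 < g)%N by apply: leq_trans g2.
      have r0 : 0 <= A * Q.+1%:R ^+ 2 / g%:R ^+ 2 + B.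
        by rewrite addr_ge0 // divr_ge0 ?sqr_ge0 // mulr_ge0 ?sqr_ge0 // ltW.
      case: ifP => gm; last by rewrite normr0.
      apply: le_trans (HB _ _ _ _) _.
        by rewrite -muln_gcdr coprimeMl coprime_inv_mod //.

      rewrite lerD2r -mulrA ler_wpM2l ?(ltW A0) // -expr_div_n ler_sqr ?nnegrE ?divr_ge0 //.
      by rewrite ler_pdivlMr ?ltr0n // -natrM ler_nat leq_divM.
    rewrite big_split /= -mulr_sumr sumr_const_nat; apply: lerD.
      rewrite -[leRHS]mulrA [leRHS]mulrC ler_wpM2l ?sum_inv_sqr_le //.
      by rewrite mulr_ge0 ?sqr_ge0 // ltW.
    by rewrite -[leLHS]mulr_natr ler_wpM2l // ler_nat; lia.
  have h1 : `|e s r Q.+1| <= F Q.+1 + `|S|.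
    have -> : e s r Q.+1 = (e s r Q.+1 + S) - S by ring.
    by apply: le_trans (ler_normB _ _) _; rewrite lerD2r.
  have h2 := le_trans (ler_norm _) (HB1 Q.+1).
  have h3 := le_trans (ler_norm _) (HB2 Q.+1).
  have h4 := ler_norm B1; have h5 := ler_norm B2.
  by move: HS h1 h2 h3 h4 h5; lra.
(* The iteration starts from the trivial count [Q (Q + 1) <= 2 Q ^ 2 + 2]. *)
have base : P (l + 2).
  exists 2; split => // s r Q _; rewrite /e.
  apply: le_trans (ler_normB _ _) _; rewrite normr_nat ger0_norm; last by rewrite (mulr_ge0 l0) ?sqr_ge0.
  have h : (coprime_count J m s r Q)%:R <= Q%:R * (Q%:R + 1) :> R.
    by rewrite natr1 -natrM ler_nat frac_count_le.
  have : 0 <= (Q%:R - 1) ^+ 2 :> R by exact: sqr_ge0.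
  have : 0 <= Q%:R :> R by [].
  by move: h; rewrite expr2; nra.
have it n : P ((7 / 8) ^+ n * (l + 2)).
  elim: n => [|n IH]; first by rewrite expr0 mul1r.
  by rewrite exprS -mulrA; apply: step => //; rewrite mulr_gt0 ?exprn_gt0 //; lra.
move=> delta delta0.
have [n Hn] : exists n, (7 / 8) ^+ n * (l + 2) <= delta.
  have dl : 0 < delta / (l + 2) by rewrite divr_gt0 //; lra.
  (* A weak form of Bernoulli's inequality, enough for an explicit [n]. *)
  have bern n : 1 + n%:R / 8 <= (8 / 7) ^+ n :> R.
    elim: n => [|n IH]; first by rewrite expr0 mul0r addr0.
    rewrite exprS -natr1; have n0 : 0 <= n%:R :> R by [].
    have : 8 / 7 * (1 + n%:R / 8) <= 8 / 7 * (8 / 7) ^+ n :> R by rewrite ler_pM2l //; lra.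
    by lra.
  pose n := Num.truncn (8 * (l + 2) / delta); exists n.+1.
  have hn : 8 * (l + 2) / delta < n.+1%:R.
    by have /andP[] := @truncn_itv R (8 * (l + 2) / delta) ltac:(by rewrite divr_ge0 ?ltW //; lra).
  have q0 : 0 < (8 / 7) ^+ n.+1 :> R by rewrite exprn_gt0 //; lra.
  have -> : 7 / 8 = (8 / 7)^-1 :> R by lra.
  rewrite exprVn mulrC ler_pdivrMr //.
  move: hn; rewrite ltr_pdivrMr // => hn.
  have := ler_wpM2l (ltW delta0) (bern n.+1).
  lra.
have [B [B0 HB]] := it n; exists B => s r Q srm.
apply: le_trans (HB s r Q srm) _; rewrite lerD2r ler_wpM2r ?sqr_ge0 //.
Qed.

(** * The Basel sum and its Euler factors *)

Lemma sin_le_id (R : realType) (x : R) : 0 <= x -> sin x <= x.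
Proof.
move=> x0; have sc : {within `[0, x], continuous (@sin R)}.
  by apply: continuous_subspaceT => y; exact: continuous_sin.
have [c _] := MVT_segment x0 (fun y _ => is_derive_sin y) sc; rewrite sin0 !subr0 => ->.
by rewrite -[leRHS]mul1r ler_wpM2r // cos_le1.
Qed.

Lemma id_le_tan (R : realType) (x : R) : 0 <= x < pi / 2 -> x <= tan x.
Proof.
move=> /andP[x0 xpi].
have cosx y : y \in `[0, x] -> 0 < cos y.
  rewrite in_itv /= => /andP[y0 yx]; apply: cos_gt0_pihalf.
  have := pi_gt0 R; move: y0 yx xpi; lra.
have dt y : y \in `]0, x[ -> is_derive y 1 (@tan R) ((cos y) ^- 2).
  by move=> /subset_itv_oo_cc yx; apply: is_derive_tan; rewrite gt_eqF // cosx.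
have ct : {within `[0, x], continuous (@tan R)}.
  apply/continuous_in_subspaceT => y; rewrite mem_setE => yx.
  by apply: continuous_tan; rewrite gt_eqF // cosx.
have [c cx] := MVT_segment x0 dt ct; rewrite tan0 !subr0 => ->.
by rewrite -[leLHS]mul1r ler_wpM2r // invf_ge1 ?exprn_gt0 ?cosx //.
Qed.

(** These are the inverse squares of [sin x <= x <= tan x], since [1 / sin ^ 2 x] is
    [1 / tan ^ 2 x + 1]. *)
Lemma inv_sqr_sin_bounds (R : realType) (x : R) : 0 < x < pi / 2 ->
  (x ^+ 2)^-1 <= (sin x ^+ 2)^-1 <= (x ^+ 2)^-1 + 1.
Proof.
move=> /andP[x0 xpi].
have sx : 0 < sin x by apply: sin_gt0_pihalf; rewrite x0.
have cx : 0 < cos x.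
  by apply: cos_gt0_pihalf; rewrite xpi andbT; have := pi_gt0 R; lra.
apply/andP; split.
  by rewrite lef_pV2 ?posrE ?exprn_gt0 // ler_sqr ?nnegrE ?sin_le_id // ltW.
have h : x * cos x <= sin x.
  by rewrite -ler_pdivlMr // id_le_tan // xpi ltW.
have h2 : (x * cos x) ^+ 2 <= sin x ^+ 2.
  by rewrite ler_sqr ?nnegrE // ltW // mulr_gt0.
have -> : (sin x ^+ 2)^-1 = cos x ^+ 2 / sin x ^+ 2 + 1.
  by rewrite cos2sin2; field; rewrite gt_eqF.
rewrite lerD2r ler_pdivrMr ?exprn_gt0 // mulrC ler_pdivlMr ?exprn_gt0 //.
by rewrite -exprMn mulrC.
Qed.

(** The cosine of [x / 2] is written as a sine so that both terms on the left belong to the next sum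
    in [sum_inv_sqr_sin]. *)
Lemma inv_sqr_sin_halve (R : realType) (x : R) : 0 < x < pi / 2 ->
  (sin (x / 2) ^+ 2)^-1 + (sin (pi / 2 - x / 2) ^+ 2)^-1 = 4 * (sin x ^+ 2)^-1.
Proof.
move=> /andP[x0 xpi]; set y := x / 2.
have y0 : 0 < y by rewrite /y; lra.
have ypi : y < pi / 2 by rewrite /y; lra.
have sy : sin y != 0 by rewrite gt_eqF // sin_gt0_pihalf // y0.
have cy : cos y != 0.
  by rewrite gt_eqF // cos_gt0_pihalf // ypi andbT; have := pi_gt0 R; lra.
have -> : sin (pi / 2 - y) = cos y.
  by rewrite addrC sinDpihalf cosN.
have -> : x = y *+ 2 by rewrite -mulr_natr /y; lra.
rewrite sin_mulr2n.
have -> : (sin y ^+ 2)^-1 + (cos y ^+ 2)^-1 =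
          (cos y ^+ 2 + sin y ^+ 2) / (cos y ^+ 2 * sin y ^+ 2).
  by field; rewrite sy cy.
by rewrite cos2Dsin2 -mulr_natr; field; rewrite sy cy.
Qed.

Lemma odd_angle_itv (R : realType) (n k : nat) : (k < 2 ^ n)%N ->
  0 < (k.*2.+1%:R * pi / 2 ^+ n.+2 : R) < pi / 2.
Proof.
move=> kn; have pi0 := pi_gt0 R.
have p2 : 0 < 2 ^+ n.+2 :> R by rewrite exprn_gt0.
have kx : (k.*2.+1%:R : R) + 1 <= 2 ^+ n * 2.
  by rewrite natr1 -natrX -natrM ler_nat; lia.
apply/andP; split; first by apply: divr_gt0 => //; exact: mulr_gt0.
rewrite ltr_pdivrMr // !exprS [ltLHS]mulrC -mulrA ltr_pM2l //.
lra.
Qed.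

(** Each angle [x] of level [n] yields the angles [x / 2] and [pi / 2 - x / 2] of level [n + 1], so
    the halving identity multiplies the sum by 4; level 0 is the single angle [pi / 4], with value
    2. *)
Lemma sum_inv_sqr_sin (R : realType) (n : nat) :
  \sum_(0 <= k < 2 ^ n) (sin (k.*2.+1%:R * pi / 2 ^+ n.+2 : R) ^+ 2)^-1 = 2 * 4 ^+ n.
Proof.
have pi0 := pi_gt0 R.
elim: n => [|n IH].
  rewrite expn0 big_nat1 double0 mul1r expr0 mulr1.
  have /andP[s0 cs] : (0 < sin (pi / 2 ^+ 2) :> R) && (cos (pi / 2 ^+ 2) == sin (pi / 2 ^+ 2) :> R).
    rewrite sin_gt0_pihalf ?expr2 /=; last by apply/andP; split; lra.
    rewrite -[eqbRHS]cosBpihalf -[eqbRHS]cosN; apply/eqP; congr cos; lra.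
  have := cos2Dsin2 (pi / 2 ^+ 2 : R); rewrite (eqP cs) => h.
  have -> : sin (pi / 2 ^+ 2) ^+ 2 = 2^-1 :> R by lra.
  by rewrite invrK.
rewrite [4 ^+ _]exprS mulrCA -IH mulr_sumr.
have -> : (2 ^ n.+1 = 2 ^ n + 2 ^ n)%N by rewrite expnS mul2n addnn.
rewrite (@big_cat_nat _ _ _ (2 ^ n)%N) ?leq_addr //=.
(* The upper half is reversed to pair the index [k] with [2 ^ n.+1 - 1 - k], whose angle is
   [pi / 2 - x / 2]. *)
rewrite -[X in _ + \sum_(X <= _ < _) _]add0n big_addn addnK [X in _ + X]big_nat_rev -big_split /=.
rewrite big_nat [RHS]big_nat; apply: eq_bigr => k /andP[_ kn].
set x := k.*2.+1%:R * pi / 2 ^+ n.+2 : R.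
have x0 : 0 < x < pi / 2 by exact: odd_angle_itv.
rewrite -(inv_sqr_sin_halve x0); congr ((sin _ ^+ 2)^-1 + (sin _ ^+ 2)^-1).
  by rewrite /x !exprS; field; rewrite expf_neq0 ?pnatr_eq0.
have -> : ((0 + 2 ^ n - k.+1 + 2 ^ n).*2.+1)%:R = 4 * 2 ^+ n - k.*2.+1%:R :> R.
  apply/eqP; rewrite eq_sym subr_eq -natrX -natrM -natrD eqr_nat; lia.
by rewrite /x !exprS; field; rewrite expf_neq0 ?pnatr_eq0.
Qed.

(** At the angles of level [n], [1 / x ^ 2] is [16 * 4 ^ n / pi ^ 2] times the inverse square of an
    odd number. Comparing with [1 / sin ^ 2 x] loses at most 1 for each of the [2 ^ n] angles,
    little against [4 ^ n]. *)
Lemma sum_inv_sqr_odd_dist (R : realType) (n : nat) :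
  `|\sum_(0 <= k < 2 ^ n) (k.*2.+1%:R ^+ 2)^-1 - pi ^+ 2 / 8| <= pi ^+ 2 / 16 / 2 ^+ n :> R.
Proof.
have pi0 := pi_gt0 R; have q0 : 0 < 2 ^+ n :> R by rewrite exprn_gt0.
have := sum_inv_sqr_sin R n; set T := (X in X = _ -> _) => HS; set S := \sum_(_ <= _ < _) _.
have xb k : (0 <= k < 2 ^ n)%N ->
    16 * 4 ^+ n / pi ^+ 2 * (k.*2.+1%:R ^+ 2)^-1 <=
    (sin (k.*2.+1%:R * pi / 2 ^+ n.+2 : R) ^+ 2)^-1 <=
    16 * 4 ^+ n / pi ^+ 2 * (k.*2.+1%:R ^+ 2)^-1 + 1.
  move=> /andP[_ kn]; set x := k.*2.+1%:R * pi / 2 ^+ n.+2 : R.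
  have x0 : 0 < x < pi / 2 by exact: odd_angle_itv.
  have <- : (x ^+ 2)^-1 = 16 * 4 ^+ n / pi ^+ 2 * (k.*2.+1%:R ^+ 2)^-1.
    have -> : 4 ^+ n = 2 ^+ n * 2 ^+ n :> R by rewrite -exprMn; congr (_ ^+ _); lra.
    have k0 : (k.*2.+1%:R : R) != 0 by rewrite pnatr_eq0.
    rewrite /x !exprS expr0; move: (2 ^+ n) (gt_eqF q0) (pi : R) (gt_eqF pi0) k0.
    move: k.*2.+1%:R => z u u0 p p0 z0; field.
    by rewrite u0 p0 z0.
  exact: inv_sqr_sin_bounds.
have lo : 16 * 4 ^+ n / pi ^+ 2 * S <= T.
  rewrite mulr_sumr big_nat [leRHS]big_nat; by apply: ler_sum => k /xb /andP[].
have hi : T <= 16 * 4 ^+ n / pi ^+ 2 * S + 2 ^+ n.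
  have -> : 2 ^+ n = \sum_(0 <= k < 2 ^ n) (1 : R) by rewrite sumr_const_nat subn0 natrX.
  rewrite /T mulr_sumr -big_split /= [leLHS]big_nat [leRHS]big_nat.
  by apply: ler_sum => k /xb /andP[].
have c0 : 0 < 16 * 4 ^+ n / pi ^+ 2 :> R.
  by rewrite divr_gt0 ?exprn_gt0 // mulr_gt0 ?exprn_gt0.
move: lo hi; rewrite HS => lo hi.
have cE : 16 * 4 ^+ n / pi ^+ 2 * (pi ^+ 2 / 8) = 2 * 4 ^+ n :> R.
  by move: (4 ^+ n) (pi : R) (gt_eqF pi0) => a p p0; field; rewrite p0.
have cE2 : 16 * 4 ^+ n / pi ^+ 2 * (pi ^+ 2 / 16 / 2 ^+ n) = 2 ^+ n :> R.
  have -> : 4 ^+ n = 2 ^+ n * 2 ^+ n :> R by rewrite -exprMn; congr (_ ^+ _); lra.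
  move: (2 ^+ n) (gt_eqF q0) (pi : R) (gt_eqF pi0) => a a0' p p0.
  by field; rewrite a0' p0.
rewrite -(ler_pM2l c0) cE2 -{1}(gtr0_norm c0) -normrM mulrBr cE ler_norml.
by apply/andP; split; lra.
Qed.

(** * Convergence of the sum of inverse squares and removal of primes *)

Lemma inv_sqr_sum_is_cvg (R : realType) : cvgn (inv_sqr_sum R predT).
Proof.
apply: nondecreasing_is_cvgn.
  apply/nondecreasing_seqP => n; rewrite /inv_sqr_sum [leRHS]big_nat_recr //=.
  by rewrite lerDl invr_ge0 sqr_ge0.
exists 2 => _ [Q _ <-]; rewrite /inv_sqr_sum.
case: Q => [|Q]; first by rewrite big_geq.
by rewrite big_ltn // expr1n invr1; have := sum_inv_sqr_le R Q.+1; lra.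
Qed.

(** The omitted terms are the multiples of [p]; since [P] ignores a factor [p], they form a copy of
    the same sum, scaled by [1 / p ^ 2]. *)
Lemma inv_sqr_sum_multiples (R : realType) (P : pred nat) (p Q : nat) : (0 < p)%N ->
  (forall g, P (p * g)%N = P g) ->
  inv_sqr_sum R (fun g => P g && ~~ (p %| g)%N) Q =
  inv_sqr_sum R P Q - (p%:R ^+ 2)^-1 * inv_sqr_sum R P (Q %/ p).
Proof.
move=> p0 Pp; apply/eqP; rewrite eq_sym subr_eq addrC; apply/eqP.
rewrite /inv_sqr_sum (bigID (dvdn p)) /=; congr (_ + _).
rewrite big_mkcond (@big_multiples _ _ _ _ p) //=; last first.
  by move=> n /negPf ->; rewrite andbF.
rewrite mulr_sumr [RHS]big_mkcond; apply: eq_bigr => g _.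
by rewrite dvdn_mulr // andbT Pp natrM exprMn invfM.
Qed.

Lemma cvg_divn (p : nat) : (0 < p)%N -> (Q %/ p)%N @[Q --> \oo] --> \oo.
Proof.
move=> p0; apply/cvgnyPge => A; exists (A * p)%N => //= Q.
by rewrite /= leq_divRL.
Qed.

Lemma inv_sqr_sum_sieve (R : realType) (P : pred nat) (p : nat) (L : R) : (0 < p)%N ->
  (forall g, P (p * g)%N = P g) ->
  inv_sqr_sum R P @ \oo --> L ->
  inv_sqr_sum R (fun g => P g && ~~ (p %| g)%N) @ \oo --> L * (1 - (p%:R ^+ 2)^-1).
Proof.
move=> p0 Pp PL.
have -> : inv_sqr_sum R (fun g => P g && ~~ (p %| g)%N) =
   (fun Q => inv_sqr_sum R P Q - (p%:R ^+ 2)^-1 * inv_sqr_sum R P (Q %/ p)).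
  by apply/funext => Q; exact: inv_sqr_sum_multiples.
rewrite mulrBr mulr1 [L * _]mulrC; apply: cvgB => //.
by apply: cvgMr; exact: (cvg_comp _ _ (cvg_divn p0) PL).
Qed.

(** The limit [L] exists by monotonicity. Sieving by 2 multiplies it by [3 / 4], while the odd
    terms, summed up to [2 ^ n.+1], tend to [pi ^ 2 / 8]. *)
Lemma basel (R : realType) : inv_sqr_sum R predT @ \oo --> (pi ^+ 2 / 6 : R).
Proof.
have /cvg_ex [L HL] := @inv_sqr_sum_is_cvg R.
suff <- : L = pi ^+ 2 / 6 by [].
have E n : inv_sqr_sum R (fun g => predT g && ~~ (2 %| g)%N) (2 ^ n.+1) =
   \sum_(0 <= k < 2 ^ n) (k.*2.+1%:R ^+ 2)^-1.
  rewrite /inv_sqr_sum expnS mul2n big_mkcond; elim: (2 ^ n)%N => [|k IH].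
    by rewrite !big_geq.
  rewrite doubleS [RHS]big_nat_recr //= -IH.
  rewrite (big_nat_recr k.*2.+2) //= (big_nat_recr k.*2.+1) //=.
  by rewrite !dvdn2 /= odd_double /= addr0.
have E_cvg : (fun n => \sum_(0 <= k < 2 ^ n) (k.*2.+1%:R ^+ 2)^-1) @ \oo --> (pi ^+ 2 / 8 : R).
  have geo : @geometric R (pi ^+ 2 / 16) 2^-1 @ \oo --> 0.
    by apply: cvg_geometric; rewrite ger0_norm; lra.
  apply/cvgrPdist_le => eps eps0.
  move/cvgrPdist_le : geo => /(_ _ eps0); apply: filterS => n /=.
  rewrite sub0r normrN ger0_norm; last by rewrite mulr_ge0 ?exprn_ge0 // divr_ge0 ?sqr_ge0.
  rewrite distrC exprVn; exact: le_trans (sum_inv_sqr_odd_dist R n).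
have exp_cvg : (2 ^ n.+1)%N @[n --> \oo] --> \oo.
  apply/cvgnyPge => A; exists A => //= n /= An.
  by rewrite (leq_trans An) // ltnW // (ltn_trans (ltn_expl n (isT : 1 < 2)%N)) // ltn_exp2l.
have odd_cvg := @inv_sqr_sum_sieve R predT 2 L isT (fun=> erefl) HL.
have lim2 := cvg_comp _ _ exp_cvg odd_cvg.
have : L * (1 - (2 ^+ 2)^-1) = pi ^+ 2 / 8.
  apply: (cvg_unique (@Rhausdorff R) lim2).
  by rewrite (_ : _ \o _ = fun n => \sum_(0 <= k < 2 ^ n) (k.*2.+1%:R ^+ 2)^-1) //; apply/funext.
by lra.
Qed.

Lemma sieved_inv_sqr_sum_cvg (R : realType) (ps : seq nat) :
  uniq ps -> all prime ps ->
  inv_sqr_sum R (fun g => all (fun p => ~~ (p %| g)%N) ps) @ \oo -->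
  (pi ^+ 2 / 6 * \prod_(p <- ps) (1 - (p%:R ^+ 2)^-1) : R).
Proof.
elim: ps => [_ _|p ps IH /= /andP[pps ups] /andP[pp aps]].
  by rewrite big_nil mulr1; exact: basel.
rewrite big_cons [X in _ * X]mulrC mulrA.
rewrite (_ : (fun g => _) = (fun g => all (fun p => ~~ (p %| g)%N) ps && ~~ (p %| g)%N)).
  apply: inv_sqr_sum_sieve; [exact: prime_gt0| |exact: IH].
  move=> g; apply: eq_in_all => p' p'ps.
  have p'p := allP aps _ p'ps; rewrite Euclid_dvdM // dvdn_prime2 //.
  by case: eqP => // pE; move: pps; rewrite -pE p'ps.
by apply/funext => g; rewrite andbC.
Qed.

Lemma inv_sqr_sum_coprime_cvg (R : realType) (m : nat) : (0 < m)%N ->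
  inv_sqr_sum R (coprime^~ m) @ \oo -->
  (pi ^+ 2 / 6 * \prod_(p <- primes m) (1 - (p%:R ^+ 2)^-1) : R).
Proof.
move=> m0.
have h := @sieved_inv_sqr_sum_cvg R _ (primes_uniq m) (all_prime_primes m).
apply: cvg_trans h; apply: near_eq_cvg; near=> Q.
rewrite /inv_sqr_sum big_mkcond [RHS]big_mkcond big_nat [RHS]big_nat /=.
apply: eq_bigr => g /andP[g0 _]; congr (if _ then _ else _).
rewrite coprime_has_primes // -all_predC; apply: eq_in_all => p pm /=.
by rewrite mem_primes g0 (allP (all_prime_primes m) _ pm).
Unshelve. all: by end_near. Qed.

Lemma quad_small_cvg (R : realType) (u : nat -> R) (l : R) :
  u @ \oo --> l -> quad_small (fun Q => (u Q - l) * Q%:R ^+ 2).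
Proof.
move=> ul eta eta0; move/cvgrPdist_le : ul => /(_ _ eta0) [N _ HN].
(* The finitely many values before the threshold [N] are absorbed by their sum. *)
exists (\sum_(0 <= Q < N) `|(u Q - l) * Q%:R ^+ 2|) => Q.
have S0 : 0 <= \sum_(0 <= Q < N) `|(u Q - l) * Q%:R ^+ 2| by apply: sumr_ge0.
have [QN|NQ] := ltnP Q N.
  rewrite ler_wpDl //; first by rewrite mulr_ge0 ?sqr_ge0 // ltW.
  rewrite (bigD1_seq Q) ?mem_index_iota ?iota_uniq //= lerDl; exact: sumr_ge0.
rewrite ler_wpDr // normrM [`|_ ^+ 2|]ger0_norm ?sqr_ge0 // ler_wpM2r ?sqr_ge0 //.
by rewrite distrC; exact: HN.
Qed.

Lemma euler_factor_gt0 (R : realType) (m : nat) :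
  0 < \prod_(p <- primes m) (1 - (p%:R ^+ 2)^-1) :> R.
Proof.
rewrite big_seq; apply: prodr_gt0 => p; rewrite mem_primes => /andP[pp _].
have p1 : 1 < p%:R :> R by rewrite ltr1n prime_gt1.
by rewrite subr_gt0 invf_lt1 ?exprn_egt1 ?exprn_gt0 // (lt_trans _ p1).
Qed.

(** * Farey fractions with denominators congruent to 1 *)

Definition frac (R : realType) (p : nat * nat) : R := p.1%:R / p.2%:R.

Lemma frac_inj (R : realType) (a q a' q' : nat) : (0 < q)%N -> (0 < q')%N ->
  coprime a q -> coprime a' q' ->
  a%:R / q%:R = a'%:R / q'%:R :> R -> a = a' /\ q = q'.
Proof.
move=> q0 q0' aq aq' /eqP; rewrite eqr_div ?pnatr_eq0 -?lt0n // -!natrM eqr_nat => /eqP E.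
have qq' : q = q'.
  apply/eqP; rewrite eqn_dvd; apply/andP; split.
    have : (q %| a * q')%N by rewrite E dvdn_mull.
    by rewrite Gauss_dvdr // coprime_sym.
  have : (q' %| a' * q)%N by rewrite -E dvdn_mull.
  by rewrite Gauss_dvdr // coprime_sym.
by move: E; rewrite qq' => /eqP; rewrite eqn_pmul2r // => /eqP.
Qed.

Definition farey_mod1_rel (R : realType) (I : set R) (m : nat) : rel nat :=
  fun a q => [&& coprime a q, `[< I (a%:R / q%:R) >] & q == 1 %[mod m]].

(** Reduced fractions have unique numerators and denominators: no point is listed twice, and the
    denominator bounded by [Q] is the one required to be 1 modulo [m]. *)
Lemma perm_points_farey_mod1 (R : realType) (I : set R) (m Q : nat) :
  I `<=` `[0, 1] ->
  perm_eq (points (farey_mod1 I m Q)) (map (@frac R) (frac_seq (farey_mod1_rel I m) Q)).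
Proof.
move=> I01; apply: uniq_perm.
- by rewrite sort_uniq finmap.fset_uniq.
- rewrite map_inj_in_uniq ?frac_seq_uniq // => -[a q] [a' q'].
  rewrite !mem_frac_seq /frac /= => /and3P[/and3P[aq _ _] /andP[q0 _] _].
  move=> /and3P[/and3P[aq' _ _] /andP[q0' _] _] /(frac_inj q0 q0' aq aq') [-> ->] //.
move=> x; rewrite mem_points; last exact: finite_farey_mod1.
apply/idP/idP.
  move=> /set_mem [[a [q [qQ aq cop ->]]] Ix [q' [a' [q0' cop' E]] q'm]].
  have /andP[q0 _] := qQ.
  have [_ qE] := frac_inj q0 q0' cop cop' E.
  apply/mapP; exists (a, q) => //; rewrite mem_frac_seq qQ aq !andbT.
  by rewrite /farey_mod1_rel cop /=; apply/andP; split; [exact/asboolP|rewrite qE; exact/eqP].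
move=> /mapP [[a q]]; rewrite mem_frac_seq => /and3P[/and3P[cop /asboolP Ix /eqP qm] qQ aq] ->.
apply/mem_set; have /andP[q0 _] := qQ.
by split => //; [exists a, q | exists q => //; exists a].
Qed.

(** The asymptotics fix the classes of both numerator and denominator, so the numerators are split
    into their [m] classes. With denominators in the class of 1, each [s] is admissible. *)
Lemma size_points_farey_mod1 (R : realType) (I : set R) (m Q : nat) : (0 < m)%N ->
  I `<=` `[0, 1] ->
  size (points (farey_mod1 I m Q)) =
  (\sum_(s < m) coprime_count (fun x => `[< I x >]) m s 1 Q)%N.
Proof.
move=> m0 I01; rewrite (perm_size (perm_points_farey_mod1 m Q I01)) size_map size_frac_seq.
rewrite /coprime_count /frac_count exchange_big /=; apply: eq_bigr => q _.
rewrite exchange_big /=; apply: eq_bigr => a _.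
rewrite (bigD1 (Ordinal (ltn_pmod a m0))) //= big1 ?addn0.
  by rewrite /class_rel modn_mod eqxx.
move=> s sa; rewrite /class_rel; case: eqP => [as_|]; last by rewrite !andbF.
by case/eqP: sa; apply/val_inj; rewrite /= as_ modn_small.
Qed.

Lemma farey_gap_ge (R : realType) (Q : nat) (x y : R) :
  @farey R Q x -> farey Q y -> x < y -> (Q%:R ^+ 2)^-1 <= y - x.
Proof.
move=> [a [q [/andP[q0 qQ] _ _ ->]]] [b [r [/andP[r0 rQ] _ _ ->]]].
have q0R : 0 < q%:R :> R by rewrite ltr0n.
have r0R : 0 < r%:R :> R by rewrite ltr0n.
rewrite ltr_pdivrMr // mulrAC ltr_pdivlMr // -!natrM ltr_nat => h.
have -> : b%:R / r%:R - a%:R / q%:R = (b%:R * q%:R - a%:R * r%:R) / (q%:R * r%:R) :> R.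
  by field; rewrite !gt_eqF.
have h1 : 1 <= b%:R * q%:R - a%:R * r%:R :> R.
  by rewrite lerBrDr -!natrM addrC natr1 ler_nat.
have qr0 : 0 < q%:R * r%:R :> R by rewrite mulr_gt0.
apply: (@le_trans _ _ (q%:R * r%:R)^-1).
  rewrite lef_pV2 ?posrE ?exprn_gt0 ?ltr0n ?(leq_trans q0) //.
  by rewrite expr2 ler_pM // ler_nat.
by rewrite -[leLHS]mul1r ler_pM2r ?invr_gt0.
Qed.

(** A fraction [c / e] strictly between has [e = q x + (q + d) y] with [x = (a + b) e - c (q + d)]
    and [y = c q - a e], both positive integers. *)
Lemma farey_neighbours (a q b d e c : nat) : (0 < q)%N ->
  (b * q = a * d + 1)%N -> (a * e < c * q)%N -> (c * (q + d) < (a + b) * e)%N ->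
  (2 * q + d <= e)%N.
Proof.
move=> q0 det h1 h2.
have : (e * (b * q) = e * (a * d + 1))%N by rewrite det.
nia.
Qed.

Lemma sorted_adjacent (R : realType) (s : seq R) (x y : R) :
  sorted <%R s -> x \in s -> y \in s -> x < y ->
  (forall z, z \in s -> x < z -> y <= z) ->
  exists j, [/\ (j.+1 < size s)%N, nth 0 s j = x & nth 0 s j.+1 = y].
Proof.
move=> ss xs ys xy adj.
have lt_nth i j : (i < j)%N -> (j < size s)%N -> nth 0 s i < nth 0 s j.
  by move=> ij js; apply: (sorted_ltn_nth lt_trans 0 ss) => //; rewrite inE (ltn_trans ij).
have ixs : (index x s < size s)%N by rewrite index_mem.
have iys : (index y s < size s)%N by rewrite index_mem.
have xE : nth 0 s (index x s) = x by exact: nth_index.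
have yE : nth 0 s (index y s) = y by exact: nth_index.
have ixy : (index x s < index y s)%N.
  rewrite ltnNge leq_eqVlt; apply/negP => /orP[/eqP E|h].
    by move: xy; rewrite -xE -yE E ltxx.
  by have := lt_nth _ _ h ixs; rewrite xE yE ltNge (ltW xy).
have jy : index y s = (index x s).+1.
  apply/eqP; rewrite eqn_leq ixy andbT leqNgt; apply/negP => h.
  have := lt_nth _ _ h iys; rewrite yE ltNge adj //.
    by apply: mem_nth; apply: ltn_trans iys.
  by rewrite -[ltLHS]xE lt_nth // (leq_ltn_trans _ iys).
by exists (index x s); split; rewrite ?xE -?jy ?yE.
Qed.

(** * The repulsion constant and the number of points *)

Definition repulsion_const (R : realType) (m : nat) : R :=
  3 / (pi ^+ 2 * m%:R * \prod_(p <- primes m) (1 - (p%:R ^+ 2)^-1)).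

Lemma repulsion_const_gt0 (R : realType) (m : nat) : (0 < m)%N ->
  0 < repulsion_const R m.
Proof.
move=> m0; rewrite /repulsion_const; apply: divr_gt0 => //.
by rewrite !mulr_gt0 ?exprn_gt0 ?pi_gt0 ?euler_factor_gt0 ?ltr0n.
Qed.

(** For [Z] equal to [pi ^ 2 / 6] times the Euler factors, [1 / (2 m ^ 2 Z)] is the repulsion
    constant over [m]: every class of numerators gets an equal share. *)
Lemma coprime_count_itv (R : realType) (J : pred R) (alpha beta : R) (m : nat) :
  0 <= alpha -> alpha <= beta -> beta <= 1 ->
  (forall x, J x -> alpha <= x <= beta) -> (forall x, alpha < x < beta -> J x) ->
  (0 < m)%N ->
  forall delta : R, 0 < delta -> exists B : R, forall s r Q, coprime (gcdn s r) m ->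
    `|(coprime_count J m s r Q)%:R - repulsion_const R m * (beta - alpha) / m%:R * Q%:R ^+ 2|
      <= delta * Q%:R ^+ 2 + B.
Proof.
move=> a0 ab b1 Jsub subJ m0 delta delta0.
have pr0 := @euler_factor_gt0 R m; have pi0 := pi_gt0 R.
set Z : R := pi ^+ 2 / 6 * \prod_(p <- primes m) (1 - (p%:R ^+ 2)^-1).
have Z0 : 0 < Z by rewrite /Z mulr_gt0 // divr_gt0 ?exprn_gt0.
have zQ := quad_small_cvg (@inv_sqr_sum_coprime_cvg R m m0).
have [B HB] := coprime_count_asymp a0 ab b1 Jsub subJ m0 Z0 zQ delta0.
exists B => s r Q /(HB s r Q); congr (`| _ - _ * _ | <= _).
have m0R : (m%:R : R) != 0 by rewrite pnatr_eq0 -lt0n.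
rewrite /repulsion_const /Z; move: (\prod_(_ <- _) _) (gt_eqF pr0) (pi : R) (gt_eqF pi0) => p p0 t t0.
by field; rewrite p0 t0 m0R.
Qed.

Lemma size_points_asymp (R : realType) (I : set R) (alpha beta : R) (m : nat) :
  0 <= alpha -> alpha <= beta -> beta <= 1 ->
  (forall x, I x -> alpha <= x <= beta) -> (forall x, alpha < x < beta -> I x) ->
  (0 < m)%N ->
  quad_small (fun Q => (size (points (farey_mod1 I m Q)))%:R -
     repulsion_const R m * (beta - alpha) * Q%:R ^+ 2).
Proof.
move=> a0 ab b1 Isub subI m0 eta eta0.
have m0R : 0 < m%:R :> R by rewrite ltr0n.
have I01 : I `<=` `[0, 1].
  move=> x /Isub /andP[ax xb]; rewrite /= in_itv /=; lra.
have Jsub x : `[< I x >] -> alpha <= x <= beta by move=> /asboolP /Isub.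
have subJ x : alpha < x < beta -> `[< I x >] by move=> /subI ?; apply/asboolP.
have [B HB] := coprime_count_itv a0 ab b1 Jsub subJ m0 (divr_gt0 eta0 m0R).
exists (m%:R * B) => Q; rewrite size_points_farey_mod1 // natr_sum.
have -> : repulsion_const R m * (beta - alpha) * Q%:R ^+ 2 =
   \sum_(s < m) repulsion_const R m * (beta - alpha) / m%:R * Q%:R ^+ 2.
  by rewrite sumr_const card_ord -[RHS]mulr_natr [RHS]mulrAC divfK // gt_eqF.
have -> : eta * Q%:R ^+ 2 + m%:R * B = \sum_(s < m) (eta / m%:R * Q%:R ^+ 2 + B).
  rewrite sumr_const card_ord -[RHS]mulr_natl mulrDr; congr (_ + _).
  by field; rewrite gt_eqF.
rewrite -sumrB; apply: le_trans (ler_norm_sum _ _ _) _; apply: ler_sum => s _.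
by apply: HB; rewrite gcdn1 coprime1n.
Qed.

Lemma near_quad_small (R : realType) (f : nat -> R) (eta : R) :
  quad_small f -> 0 < eta -> \forall Q \near \oo, `|f Q| <= eta * Q%:R ^+ 2.
Proof.
move=> sf eta0; have [B HB] := sf _ (divr_gt0 eta0 (ltr0n R 2)).
exists (Num.truncn (`|B| / (eta / 2))).+1 => //= Q /= NQ.
have e2 : 0 < eta / 2 by lra.
have QB : `|B| / (eta / 2) < Q%:R.
  have /andP[_ h] := @truncn_itv R (`|B| / (eta / 2)) (divr_ge0 (normr_ge0 _) (ltW e2)).
  by rewrite (lt_le_trans h) // ler_nat.
have Q1 : 1 <= Q%:R :> R by rewrite ler1n (leq_trans _ NQ).
move: QB; rewrite ltr_pdivrMr // => QB.
have := HB Q; have := ler_norm B.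
have : eta / 2 * (Q%:R - 1) * Q%:R >= 0 by rewrite !mulr_ge0 ?subr_ge0 // ltW.
by rewrite expr2; lra.
Qed.

Lemma near_coprime_count_gt (R : realType) (u v : R) (m : nat) :
  0 <= u -> u < v -> v <= 1 -> (0 < m)%N ->
  exists2 rho : R, 0 < rho & forall s r, coprime (gcdn s r) m ->
    \forall Q \near \oo,
      rho * Q%:R ^+ 2 <= (coprime_count (fun x => u < x < v) m s r Q)%:R.
Proof.
move=> u0 uv v1 m0.
have c0 : 0 < repulsion_const R m * (v - u) / m%:R.
  by rewrite divr_gt0 ?ltr0n // mulr_gt0 ?subr_gt0 // repulsion_const_gt0.
set c := _ / _ in c0; exists (c / 2); first by lra.
move=> s r srm.
have Jsub x : u < x < v -> u <= x <= v by move=> /andP[? ?]; rewrite !ltW.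
have sm : quad_small (fun Q => (coprime_count (fun x => u < x < v) m s r Q)%:R - c * Q%:R ^+ 2).
  move=> eta eta0.
  have [B HB] := coprime_count_itv u0 (ltW uv) v1 Jsub (fun x => id) m0 eta0.
  by exists B => Q; exact: HB.
have c2 : 0 < c / 2 by lra.
have := near_quad_small sm c2; apply: filterS => Q; rewrite ler_norml => /andP[h _].
by lra.
Qed.

Lemma frac_count_gt0 (P : rel nat) (Q : nat) : (0 < frac_count P Q)%N ->
  exists a q, [/\ P a q, (0 < q <= Q)%N & (a <= q)%N].
Proof.
rewrite -size_frac_seq; case E : (frac_seq P Q) => [//|[a q] t] _.
have : (a, q) \in frac_seq P Q by rewrite E mem_head.
by rewrite mem_frac_seq => /and3P[? ? ?]; exists a, q.
Qed.

Lemma near_farey_mod1_itv (R : realType) (I : set R) (u v : R) (m : nat) :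
  0 <= u -> u < v -> v <= 1 -> (forall x, u < x < v -> I x) -> (0 < m)%N ->
  \forall Q \near \oo, exists2 x, x \in points (farey_mod1 I m Q) & u < x < v.
Proof.
(* A single class of numerators suffices; the class of 0 is taken. *)
move=> u0 uv v1 subI m0; have [rho rho0 /(_ 0%N 1%N)] := near_coprime_count_gt u0 uv v1 m0.
rewrite gcd0n coprime1n => /(_ isT) H; near=> Q.
have Q0 : (0 < Q)%N by near: Q; exists 1%N.
have h : rho * Q%:R ^+ 2 <= (coprime_count (fun x : R => u < x < v) m 0 1 Q)%:R by near: Q.
have : (0 < coprime_count (fun x : R => u < x < v)%R m 0 1 Q)%N.
  rewrite -(ltr0n R); apply: lt_le_trans h; rewrite mulr_gt0 // exprn_gt0 // ltr0n //.
move=> /frac_count_gt0 [a [q [/andP[cop /and3P[/= auv _ /eqP qm]] qQ aq]]].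
exists (a%:R / q%:R) => //; rewrite mem_points; last exact: finite_farey_mod1.
apply/mem_set; have /andP[q0 _] := qQ.
by split; [exists a, q|exact: subI|exists q => //; exists a].
Unshelve. all: by end_near. Qed.

Lemma points_sorted (R : realType) (A : set R) : sorted <%R (points A).
Proof. by rewrite lt_sorted_uniq_le sort_uniq finmap.fset_uniq sort_le_sorted. Qed.

Lemma points_range (R : realType) (A : set R) (x : R) :
  x \in points A -> nth_point A 0 <= x <= nth_point A (gap_number A).
Proof.
move=> xA; have ixs : (index x (points A) < size (points A))%N by rewrite index_mem.
have xE : nth_point A (index x (points A)) = x by exact: nth_index.
have s0 : (0 < size (points A))%N by apply: leq_ltn_trans ixs.
have le_nth i j : (i <= j)%N -> (j < size (points A))%N -> nth_point A i <= nth_point A j.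
  by rewrite leq_eqVlt => /orP[/eqP -> //|ij] js; rewrite ltW // points_lt.
have sE : (gap_number A < size (points A))%N by rewrite /gap_number prednK.
rewrite -{1 2}xE !le_nth //.
by rewrite /gap_number -ltnS prednK.
Qed.

Lemma mem_nth_point (R : realType) (A : set R) (j : nat) :
  finite_set A -> (j < size (points A))%N -> A (nth_point A j).
Proof. by move=> fA js; apply/set_mem; rewrite -mem_points // mem_nth. Qed.

(** * Number of gaps, range, and the lower bound for the gaps *)

Section gaps.
Context {R : realType} {I : set R} {alpha beta : R} {m : nat}.
Hypotheses (a0 : 0 <= alpha) (ab : alpha < beta) (b1 : beta <= 1) (m0 : (0 < m)%N).
Hypotheses (Isub : forall x, I x -> alpha <= x <= beta)
  (subI : forall x, alpha < x < beta -> I x).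
Local Notation K := (repulsion_const R m).
Local Notation L := (beta - alpha).
Local Notation A := (farey_mod1 I m).

Lemma near_gap_number (eta : R) : 0 < eta ->
  \forall Q \near \oo, (0 < gap_number (A Q))%N /\
    (K - eta) * L * Q%:R ^+ 2 <= (gap_number (A Q))%:R <= (K + eta) * L * Q%:R ^+ 2.
Proof.
move=> eta0; have L0 : 0 < L by rewrite subr_gt0.
have K0 := @repulsion_const_gt0 R m m0.
have sm := size_points_asymp a0 (ltW ab) b1 Isub subI m0.
(* Half of [eta * L] bounds the error in the number of points; the other half covers the 1 by which
   gaps are fewer than points. The cap [K * L / 2], with [H2], forces at least four points. *)
pose e := Num.min (eta * L / 2) (K * L / 2).
have e0 : 0 < e by rewrite lt_min; apply/andP; split; apply: divr_gt0 => //; exact: mulr_gt0.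
have e_eta : e <= eta * L / 2 by rewrite ge_min lexx.
have e_K : e <= K * L / 2 by rewrite ge_min lexx orbT.
have sm1 : quad_small (fun Q => 4 * Q%:R : R) by exact: quad_smallZ (@quad_small_linear R).
have H1 := near_quad_small sm e0; have H2 := near_quad_small sm1 e0.
near=> Q.
have Q1 : 1 <= Q%:R :> R by rewrite ler1n; near: Q; exists 1%N.
have h1 : `|(size (points (A Q)))%:R - K * L * Q%:R ^+ 2| <= e * Q%:R ^+ 2 by near: Q; exact: H1.
have h2 : `|4 * Q%:R| <= e * Q%:R ^+ 2 by near: Q; exact: H2.
move: h1 h2; rewrite normrM !normr_nat ler_norml => /andP[h1 h1'] h2.
have q2 : 0 <= Q%:R ^+ 2 :> R by exact: sqr_ge0.
have hK := ler_wpM2r q2 e_K; have heta := ler_wpM2r q2 e_eta.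
have s4 : 4 <= (size (points (A Q)))%:R :> R by lra.
have s4' : (4 <= size (points (A Q)))%N by rewrite -(ler_nat R).
have gE : (gap_number (A Q))%:R = (size (points (A Q)))%:R - 1 :> R.
  by rewrite /gap_number -subn1 natrB // (leq_trans _ s4').
split; first by rewrite /gap_number -subn1 subn_gt0 (leq_trans _ s4').
rewrite gE; have -> : (K - eta) * L * Q%:R ^+ 2 = K * L * Q%:R ^+ 2 - eta * L * Q%:R ^+ 2 by ring.
have -> : (K + eta) * L * Q%:R ^+ 2 = K * L * Q%:R ^+ 2 + eta * L * Q%:R ^+ 2 by ring.
have {}heta : 2 * (e * Q%:R ^+ 2) <= eta * L * Q%:R ^+ 2.
  by rewrite mulrC -ler_pdivlMr // mulrAC.
move: h1 h1' heta h2 Q1; move: (e * Q%:R ^+ 2) (K * L * Q%:R ^+ 2) (eta * L * Q%:R ^+ 2).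
by clear => x y z *; apply/andP; split; lra.
Unshelve. all: by end_near. Qed.

Lemma range_le (Q : nat) : (0 < gap_number (A Q))%N ->
  0 < nth_point (A Q) (gap_number (A Q)) - nth_point (A Q) 0 <= L.
Proof.
move=> N0; have fA := finite_farey_mod1 I m Q.
have sN : (gap_number (A Q) < size (points (A Q)))%N.
  by move: N0; rewrite /gap_number; case: (size _).
rewrite subr_gt0 points_lt //=.
have [_ /Isub /andP[_ h1] _] := mem_nth_point fA sN.
have [_ /Isub /andP[h2 _] _] := mem_nth_point fA (ltn_trans N0 sN).
by rewrite lerB.
Qed.

Lemma near_range_ge (eta : R) : 0 < eta ->
  \forall Q \near \oo,
    (1 - eta) * L <= nth_point (A Q) (gap_number (A Q)) - nth_point (A Q) 0.
Proof.
move=> eta0; have L0 : 0 < L by rewrite subr_gt0.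
(* Each end loses at most [e * L]; the cap 1 keeps both windows inside the interval. *)
pose e := Num.min (eta / 2) 1.
have e0 : 0 < e by rewrite lt_min; apply/andP; split => //; lra.
have e_eta : e <= eta / 2 by rewrite ge_min lexx.
have e_1 : e <= 1 by rewrite ge_min lexx orbT.
clearbody e; have eL : 0 < e * L by rewrite mulr_gt0.
have eL1 : e * L <= L by rewrite ler_piMl // ltW.
have eL2 := ler_wpM2r (ltW L0) e_eta.
have uL2 : 0 <= beta - e * L :> R by move: eL1 a0; lra.
have uL : alpha + e * L <= 1 :> R by move: eL1 b1; lra.
have H1 : \forall Q \near \oo, exists2 x, x \in points (A Q) & alpha < x < alpha + e * L.
  apply: near_farey_mod1_itv => //; first lra.
  by move=> x /andP[h1 h2]; apply: subI; rewrite h1 /=; lra.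
have H2 : \forall Q \near \oo, exists2 x, x \in points (A Q) & beta - e * L < x < beta.
  apply: near_farey_mod1_itv => //; try lra.
  by move=> x /andP[h1 h2]; apply: subI; rewrite h2 andbT; lra.
near=> Q.
have [x xA /andP[_ hx]] : exists2 x, x \in points (A Q) & alpha < x < alpha + e * L.
  by near: Q.
have [y yA /andP[hy _]] : exists2 y, y \in points (A Q) & beta - e * L < y < beta.
  by near: Q.
have /andP[h1 _] := points_range xA; have /andP[_ h2] := points_range yA.
lra.
Unshelve. all: by end_near. Qed.

(** Gaps are at least [1 / Q ^ 2], the range is at most [L], and eventually the number of gaps
    exceeds [c L Q ^ 2], so every normalized gap exceeds [c]. *)
Lemma near_gap_measure_eq0 (c : R) : 0 <= c < K ->
  \forall Q \near \oo, gap_measure (A Q) `[0, c]%classic = 0%E.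
Proof.
move=> /andP[c0 cK]; have L0 : 0 < L by rewrite subr_gt0.
have eta0 : 0 < (K - c) / 2 by lra.
have H := near_gap_number eta0; near=> Q.
have Q0 : (0 < Q)%N by near: Q; exists 1%N.
have [N0 /andP[Nlo _]] : (0 < gap_number (A Q))%N /\
    (K - (K - c) / 2) * L * Q%:R ^+ 2 <= (gap_number (A Q))%:R <=
    (K + (K - c) / 2) * L * Q%:R ^+ 2 by near: Q.
rewrite gap_measure_itv // eq_card0 ?mulr0 // => j; rewrite inE; apply/negbTE; rewrite -ltNge.
have fA := finite_farey_mod1 I m Q.
have js : (j.+1 < size (points (A Q)))%N.
  by have := ltn_ord j; rewrite {2}/gap_number; case: (size _).
have [Fj _ _] := mem_nth_point fA (ltnW js); have [Fj1 _ _] := mem_nth_point fA js.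
have gap := farey_gap_ge Fj Fj1 (points_lt (ltnSn j) js).
have /andP[_ rng] := range_le N0.
have Q2 : 0 < Q%:R ^+ 2 :> R by rewrite exprn_gt0 // ltr0n.
apply: (@le_lt_trans _ _ (c * L)); first by rewrite ler_wpM2l.
apply: (@lt_le_trans _ _ ((gap_number (A Q))%:R * (Q%:R ^+ 2)^-1)); last by rewrite ler_wpM2l.
rewrite ltr_pdivlMr //; apply: lt_le_trans Nlo.
by rewrite ltr_pM2r // ltr_pM2r //; lra.
Unshelve. all: by end_near. Qed.

End gaps.

(** * A positive proportion of almost minimal gaps *)

Lemma bezout_window (b d W : nat) : (0 < W)%N -> (0 < b)%N -> (0 < d)%N -> coprime b d ->
  exists a q : nat, [/\ (W <= q < W + d)%N & (b * q = a * d + 1)%N].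
Proof.
(* This is the representative in the window of the inverse of [b] modulo [d]; adding [d * W] keeps
   the subtraction from truncating. *)
move=> W0 b0 d0 bd; pose q := (W + (inv_mod d b + d * W - W) %% d)%N.
have q0 : (0 < b * q)%N by rewrite muln_gt0 b0 /q addn_gt0 W0.
have bq : (b * q = 1 %[mod d])%N.
  have WdW : (W <= inv_mod d b + d * W)%N by rewrite (leq_trans (leq_pmull W d0)) ?leq_addl.
  rewrite /q -modnMmr modnDmr subnKC // modnMmr -(inv_modP bd).
  by rewrite -modnMmr -modnDmr modnMr addn0 modnMmr.
exists ((b * q - 1) %/ d)%N, q; split; first by rewrite leq_addr ltn_add2l ltn_mod.
move/eqP: bq; rewrite eqn_mod_dvd // => /divnK ->; by rewrite subnK.
Qed.

Lemma coprime_det (a q b d : nat) : (b * q = a * d + 1)%N -> coprime a q.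
Proof.
move=> det; rewrite /coprime -dvdn1 -(dvdn_addr 1 (dvdn_mulr d (dvdn_gcdl a q))) -det.
by rewrite dvdn_mull ?dvdn_gcdr.
Qed.

Lemma mediant_det_l (a q b d : nat) : (b * q = a * d + 1)%N ->
  ((a + b) * q = a * (q + d) + 1)%N.
Proof. by move=> det; rewrite mulnDl mulnDr det addnA. Qed.

Lemma mediant_det_r (a q b d : nat) : (b * q = a * d + 1)%N ->
  (b * (q + d) = (a + b) * d + 1)%N.
Proof. by move=> det; rewrite mulnDr mulnDl det addnAC. Qed.

(** Half of [c - K] pays for [x], the loss from the window of denominators, and half for [eta], the
    relative error of the range and the error in the constant of the number of gaps; [eta] occurs on
    both sides, hence the factor [1 + c]. *)
Lemma gap_const_slack (R : realType) (K c eta x : R) : 0 < K -> K <= c -> 0 <= eta ->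
  eta * (1 + c) = (c - K) / 2 -> 0 <= x -> c * x <= (c - K) / 2 ->
  eta <= 1 /\ K + eta <= c * (1 - x) * (1 - eta).
Proof.
move=> K0 Kc eta0 etaE x0 cx; have c0 : 0 < c by exact: lt_le_trans Kc.
split.
  by rewrite -(ler_pM2r (ltr_wpDl ler01 c0)) etaE; lra.
have cxe : 0 <= c * x * eta by rewrite !mulr_ge0 // ltW.
have -> : c * (1 - x) * (1 - eta) = c - c * x + eta - eta * (1 + c) + c * x * eta by ring.
by rewrite etaE; lra.
Qed.

Lemma sqr_sub_ge (R : realType) (q e x : R) : 0 <= q -> e <= q * x ->
  q ^+ 2 * (1 - 4 * x) <= (q - 2 * e) ^+ 2.
Proof.
move=> q0 h; rewrite -subr_ge0.
have -> : (q - 2 * e) ^+ 2 - q ^+ 2 * (1 - 4 * x) = 4 * (q * (q * x - e)) + 4 * e ^+ 2 by ring.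
apply: addr_ge0; apply: mulr_ge0 => //; last exact: sqr_ge0.
by apply: mulr_ge0 => //; rewrite subr_ge0.
Qed.

Section neighbours.
Context {R : realType} {I : set R} {alpha beta : R} {m : nat}.
Hypotheses (a0 : 0 <= alpha) (ab : alpha < beta) (b1 : beta <= 1) (m0 : (0 < m)%N).
Hypotheses (Isub : forall x, I x -> alpha <= x <= beta)
  (subI : forall x, alpha < x < beta -> I x).
Local Notation K := (repulsion_const R m).
Local Notation L := (beta - alpha).
Local Notation A := (farey_mod1 I m).

(** With [q] in the window of length [d] from [Q - 2 E], both [q] and [q + d] are at most [Q], while
    [2 q + d > Q] excludes fractions in between by [farey_neighbours]. Modulo [m], [b q = a d + 1]
    reads [q = 1], and then [q + d = 1] too. *)
Lemma farey_mod1_neighbours (b d E Q : nat) :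
  coprime b d -> (0 < d <= E)%N -> (b = 1 %[mod m])%N -> (d = 0 %[mod m])%N ->
  (alpha + beta) / 2 < b%:R / d%:R < beta ->
  (4 * E <= Q)%N -> 2 <= L * (Q - 2 * E)%:R ->
  exists a q : nat, [/\ (Q - 2 * E <= q)%N, (b * q = a * d + 1)%N,
    A Q (a%:R / q%:R), A Q ((a + b)%:R / (q + d)%:R) &
    forall z : R, farey Q z -> a%:R / q%:R < z -> (a + b)%:R / (q + d)%:R <= z].
Proof.
move=> bd /andP[d0 dE] bm dm /andP[bdlo bdhi] EQ LW.
have W0 : (0 < Q - 2 * E)%N by lia.
have d0R : 0 < d%:R :> R by rewrite ltr0n.
have b0 : (0 < b)%N.
  rewrite -(ltr0n R) -(pmulr_lgt0 _ (_ : 0 < d%:R^-1)) ?invr_gt0 //.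
  have mid0 : 0 < (alpha + beta) / 2 :> R by move: a0 ab; lra.
  exact: lt_trans bdlo.
have [a [q [/andP[Wq qW] det]]] := bezout_window W0 b0 d0 bd.
have q0 : (0 < q)%N by apply: leq_trans Wq.
have qd0 : (0 < q + d)%N by rewrite addn_gt0 q0.
have det2 := mediant_det_l det.
have det3 := mediant_det_r det.
have q0R : 0 < q%:R :> R by rewrite ltr0n.
have qd0R : 0 < (q + d)%:R :> R by rewrite ltr0n.
have detR : b%:R * q%:R = a%:R * d%:R + 1 :> R by rewrite -!natrM det natrD.
have b_lt_d : (b < d)%N.
  by rewrite -(ltr_nat R) -[ltRHS]mul1r -ltr_pdivrMr // (lt_le_trans bdhi).
have qdQ : (q + d <= Q)%N by clear -qW dE EQ; lia.
have aq : (a <= q)%N.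
  rewrite -(leq_pmul2r d0) [leqRHS]mulnC (@leq_trans (b * q)) ?det ?leq_addr // -det.
  by rewrite leq_mul2r ltnW ?orbT.
(* Here [a / q] lies [1 / (q d) <= L / 2] to the left of [b / d], which is why [b / d] is taken in
   the right half of the interval. *)
have lo : alpha < a%:R / q%:R.
  have E1 : a%:R / q%:R = b%:R / d%:R - (q%:R * d%:R)^-1 :> R.
    have -> : a%:R = (b%:R * q%:R - 1) / d%:R :> R.
      by rewrite detR addrK mulfK // gt_eqF.
    by field; rewrite !gt_eqF.
  have h1 : (q%:R * d%:R)^-1 <= L / 2.
    apply: (@le_trans _ _ ((Q - 2 * E)%:R^-1)).
      rewrite lef_pV2 ?posrE ?mulr_gt0 ?ltr0n //.
      by rewrite -natrM ler_nat (leq_trans Wq) // leq_pmulr.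
    by rewrite ler_pdivlMr // mulrC ler_pdivrMr ?ltr0n.
  rewrite E1; lra.
have lt12 : a%:R / q%:R < (a + b)%:R / (q + d)%:R :> R.
  by rewrite ltr_pdivrMr // mulrAC ltr_pdivlMr // -!natrM ltr_nat det2 addn1.
have hi : (a + b)%:R / (q + d)%:R < beta.
  apply: lt_trans bdhi; rewrite ltr_pdivrMr // mulrAC ltr_pdivlMr // -!natrM ltr_nat.
  by rewrite det3 addn1.
have mdvd : (m %| d)%N by rewrite /dvdn dm mod0n.
have qm : (q = 1 %[mod m])%N.
  have : (b * q = 1 %[mod m])%N by rewrite det -modnDml (eqP (dvdn_mull a mdvd)).
  by rewrite -modnMml bm modnMml mul1n.
exists a, q; split => //.
- split; [exists a, q|by apply: subI; rewrite lo (lt_trans lt12)|exists q => //; exists a].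
    split => //; last exact: coprime_det det.
    by rewrite q0 (leq_trans (leq_addr d q)).
  by split => //; exact: coprime_det det.
- split; [exists (a + b)%N, (q + d)%N|by apply: subI; rewrite hi (lt_trans lo)|].
    by split; rewrite ?qd0 //; [rewrite leq_add // ltnW|exact: coprime_det det3].
  exists (q + d)%N; first by exists (a + b)%N; split => //; exact: coprime_det det3.
  by rewrite -modnDmr dm mod0n addn0.
move=> z [c [e [/andP[e0 eQ] _ _ ->]]] h1; rewrite leNgt; apply/negP => h2.
have e0R : 0 < e%:R :> R by rewrite ltr0n.
move: h1; rewrite ltr_pdivrMr // mulrAC ltr_pdivlMr // -!natrM ltr_nat => h1.
move: h2; rewrite ltr_pdivrMr // mulrAC ltr_pdivlMr // -!natrM ltr_nat => h2.
have := farey_neighbours q0 det h1 h2; clear -Wq EQ d0 eQ; lia.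
Qed.

Definition is_small_gap (c : R) (Q j : nat) : bool :=
  (gap_number (A Q))%:R * (nth_point (A Q) j.+1 - nth_point (A Q) j) <=
  c * (nth_point (A Q) (gap_number (A Q)) - nth_point (A Q) 0).

(* Distinct pairs (b, d) give distinct gaps because b = a' - a and d = q' - q are
   recovered from the reduced end points a / q < a' / q' of the gap. *)
Lemma coprime_count_le_small_gaps (c : R) (E Q : nat) :
  0 <= c -> (4 * E <= Q)%N -> 2 <= L * (Q - 2 * E)%:R ->
  (gap_number (A Q))%:R <= c * (Q - 2 * E)%:R ^+ 2 *
     (nth_point (A Q) (gap_number (A Q)) - nth_point (A Q) 0) ->
  (coprime_count (fun x => (alpha + beta) / 2 < x < beta)%R m 1 0 E <=
   #|[pred j : 'I_(gap_number (A Q)) | is_small_gap c Q j]|)%N.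
Proof.
move=> c0 EQ LW hsmall.
rewrite /coprime_count -size_frac_seq.
set s := frac_seq _ _.
have W0 : (0 < Q - 2 * E)%N.
  by rewrite lt0n; apply: contraTneq LW => ->; rewrite mulr0 -ltNge.
pose rel (p : nat * nat) (j : nat) := [/\ (j < gap_number (A Q))%N, is_small_gap c Q j &
  exists a q : nat, [/\ (0 < q)%N, (p.1 * q = a * p.2 + 1)%N,
    nth_point (A Q) j = a%:R / q%:R &
    nth_point (A Q) j.+1 = (a + p.1)%:R / (q + p.2)%:R]].
have ex p : exists j, p \in s -> rel p j.
  have [ps|pNs] := boolP (p \in s); last by exists 0%N.
  move: ps; case: p => b d; rewrite mem_frac_seq.
  move=> /and3P[/andP[bd /and3P[bdI /eqP bm /eqP dm]] dE _].
  have [a [q [Wq det Aaq Aabqd adj]]] := farey_mod1_neighbours bd dE bm dm bdI EQ LW.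
  have q0 : (0 < q)%N by apply: leq_trans Wq.
  have q0R : 0 < q%:R :> R by rewrite ltr0n.
  have qd0R : 0 < (q + d)%:R :> R by rewrite ltr0n addn_gt0 q0.
  have det2 := mediant_det_l det.
  have lt12 : a%:R / q%:R < (a + b)%:R / (q + d)%:R :> R.
    by rewrite ltr_pdivrMr // mulrAC ltr_pdivlMr // -!natrM ltr_nat det2 addn1.
  have fA := finite_farey_mod1 I m Q.
  have mem x : A Q x -> x \in points (A Q) by move=> Ax; rewrite mem_points //; exact/mem_set.
  have [|j [js jE j1E]] := sorted_adjacent (points_sorted (A Q)) (mem _ Aaq) (mem _ Aabqd) lt12.
    by move=> z; rewrite mem_points // => /set_mem [/adj].
  have jN : (j < gap_number (A Q))%N by rewrite /gap_number ltn_predRL.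
  exists j => _; split; [by []| |by exists a, q].
  rewrite /is_small_gap /nth_point jE j1E -!/(nth_point _ _).
  have /andP[/ltW r0 _] := range_le Isub (leq_ltn_trans (leq0n j) jN).
  (* This length is at most [1 / (Q - 2 E) ^ 2], so [hsmall] makes the gap small. *)
  have -> : (a + b)%:R / (q + d)%:R - a%:R / q%:R = (q%:R * (q + d)%:R)^-1 :> R.
    have detR : (a + b)%:R * q%:R = a%:R * (q + d)%:R + 1 :> R by rewrite -!natrM det2 natrD.
    have -> : (a + b)%:R = (a%:R * (q + d)%:R + 1) / q%:R :> R.
      by rewrite -detR mulfK // gt_eqF.
    by move: (q + d)%:R (gt_eqF qd0R) => t t0; field; rewrite t0 gt_eqF.
  rewrite ler_pdivrMr ?mulr_gt0 //; apply: le_trans hsmall _.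
  rewrite mulrAC ler_wpM2l ?mulr_ge0 // expr2.
  by rewrite -!natrM ler_nat leq_mul // (leq_trans Wq) // leq_addr.
have [f Hf] := boolp.choice ex.
rewrite cardE -(size_map val) -(size_map f).
apply: uniq_leq_size.
  rewrite map_inj_in_uniq ?frac_seq_uniq // => -[b d] [b' d'] ps ps'.
  have [_ _ [a [q [q0 det E1 E2]]]] := Hf _ ps.
  have [_ _ [a' [q' [q0' det' E1' E2']]]] := Hf _ ps'.
  move=> fE; rewrite -fE in E1' E2'; rewrite /= in det det' E1 E2 E1' E2'.
  have [aE qE] := frac_inj q0 q0' (coprime_det det) (coprime_det det') (etrans (esym E1) E1').
  have det2 := mediant_det_r det.
  have det2' := mediant_det_r det'.
  have := frac_inj (ltn_addr d q0) (ltn_addr d' q0') (coprime_det det2) (coprime_det det2')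
    (etrans (esym E2) E2').
  by rewrite aE qE => -[/addnI -> /addnI ->].
move=> _ /mapP [p /Hf [jN sj _] ->].
by apply/mapP; exists (Ordinal jN) => //; rewrite mem_enum.
Qed.

(** With [E] the floor of [Q / k] for a fixed large [k], there are at least a constant times [Q ^ 2]
    small gaps among at most [(K + eta) L Q ^ 2] gaps. *)
Lemma near_gap_measure_ge (c : R) : K < c ->
  exists2 rho : R, 0 < rho &
  \forall Q \near \oo, (rho%:E <= gap_measure (A Q) `[0%R, c]%classic)%E.
Proof.
move=> Kc; have K0 := @repulsion_const_gt0 R m m0.
have L0 : 0 < L by rewrite subr_gt0.
have c0 : 0 < c by apply: lt_trans Kc.
pose eta := (c - K) / (2 * (1 + c)).
have etaE : eta * (1 + c) = (c - K) / 2 by rewrite /eta; field; lra.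
have eta0 : 0 < eta by rewrite /eta divr_gt0 ?subr_gt0 // mulr_gt0 //; lra.
clearbody eta.
(* Since [(Q - 2 E) ^ 2 >= Q ^ 2 (1 - 4 / k)], this is the bound on [c x] in [gap_const_slack] at
   [x = 4 / k]; [4 <= k] ensures [4 E <= Q]. *)
have [k k4 kc] : exists2 k : nat, (4 <= k)%N & 4 * c / k%:R <= (c - K) / 2.
  have cK : 0 < c - K by rewrite subr_gt0.
  exists (Num.truncn (8 * c / (c - K))).+4 => //.
  have h : 0 <= 8 * c / (c - K) by rewrite divr_ge0 ?ltW // mulr_gt0.
  have /andP[_ h1] := truncn_itv h.
  have h2 : 8 * c / (c - K) <= (Num.truncn (8 * c / (c - K))).+4%:R.
    by rewrite ltW // (lt_le_trans h1) // ler_nat; do 3!apply: leqW.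
  rewrite ler_pdivrMr ?ltr0n //; move: h2; rewrite ler_pdivrMr //.
  by move: ((Num.truncn _).+4%:R) => t; lra.
have k0 : 0 < k%:R :> R by rewrite ltr0n (leq_trans _ k4).
have u0 : 0 <= (alpha + beta) / 2 by move: a0 ab; lra.
have uv : (alpha + beta) / 2 < beta by move: ab; lra.
have [rho rho0 Hrho] := near_coprime_count_gt u0 uv b1 m0.
have {Hrho} := Hrho 1%N 0%N; rewrite gcdn0 coprime1n => /(_ isT).
have kN : (0 < k)%N by apply: leq_trans k4.
move=> /(cvg_divn kN); set G := (X in nbhs _ X) => HG.
have KL0 : 0 < (K + eta) * L by rewrite mulr_gt0 // addr_gt0.
have k20 : 0 < (2 * k%:R) ^+ 2 :> R by rewrite exprn_gt0 // mulr_gt0.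
exists (rho / (2 * k%:R) ^+ 2 / ((K + eta) * L)); first by rewrite !divr_gt0.
have H1 := near_gap_number a0 ab b1 m0 Isub subI eta0.
have H2 := near_range_ge a0 ab b1 m0 subI eta0.
near=> Q.
have GQ : rho * (Q %/ k)%:R ^+ 2 <=
   (coprime_count (fun x => (alpha + beta) / 2 < x < beta)%R m 1 0 (Q %/ k))%:R.
  by near: Q; exact: HG.
have [N0 /andP[_ Nhi]] : (0 < gap_number (A Q))%N /\
    (K - eta) * L * Q%:R ^+ 2 <= (gap_number (A Q))%:R <= (K + eta) * L * Q%:R ^+ 2.
  by near: Q; exact: H1.
have rlo : (1 - eta) * L <= nth_point (A Q) (gap_number (A Q)) - nth_point (A Q) 0.
  by near: Q; exact: H2.
have Qk : (k <= Q)%N by near: Q; exists k.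
have QL : 4 / L <= Q%:R.
  near: Q; exists (Num.truncn (4 / L)).+1 => //= Q NQ.
  have /andP[_ h] := truncn_itv (divr_ge0 (ler0n R 4) (ltW L0)).
  by rewrite ltW // (lt_le_trans h) // ler_nat.
move: GQ; set E := (Q %/ k)%N => GQ.
have kE : (k * E <= Q)%N by rewrite mulnC leq_divM.
have EQ : (4 * E <= Q)%N by apply: leq_trans kE; rewrite leq_mul2r k4 orbT.
have Wle : 2 <= L * (Q - 2 * E)%:R.
  move: QL; rewrite ler_pdivrMr // => QL.
  have h : (Q%:R : R) <= 2 * (Q - 2 * E)%:R by rewrite -natrM ler_nat; clear -EQ; lia.
  rewrite -(@ler_pM2l _ 2) // -natrM [leRHS]mulrCA (le_trans QL) // mulrC.
  by rewrite ler_wpM2l // ltW.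
have WE : (Q - 2 * E)%:R = Q%:R - 2 * E%:R :> R by rewrite natrB ?natrM //; clear -EQ; lia.
have kER : k%:R * E%:R <= Q%:R :> R by rewrite -natrM ler_nat.
(* Rounding [Q / k] down costs at most a factor 2 once [Q >= k]. *)
have EkR : Q%:R <= 2 * k%:R * E%:R :> R.
  rewrite -!natrM ler_nat; have := ltn_ceil Q kN; rewrite -/E => h.
  have E0 : (0 < E)%N by rewrite divn_gt0.
  apply: leq_trans (ltnW h) _; rewrite [leqRHS]mulnAC leq_mul2r mul2n -addnn.
  by rewrite -addn1 leq_add2l E0 orbT.
have q0 : 0 <= Q%:R :> R by [].
have e0 : 0 <= E%:R :> R by [].
have small : (gap_number (A Q))%:R <= c * (Q - 2 * E)%:R ^+ 2 *
     (nth_point (A Q) (gap_number (A Q)) - nth_point (A Q) 0).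
  apply: le_trans Nhi _.
  have W2 : Q%:R ^+ 2 * (1 - 4 / k%:R) <= (Q - 2 * E)%:R ^+ 2 :> R.
    by rewrite WE sqr_sub_ge // ler_pdivlMr // mulrC.
  have x0 : 0 <= 4 / k%:R :> R by rewrite divr_ge0.
  have x1 : 4 / k%:R <= 1 :> R by rewrite ler_pdivrMr // mul1r ler_nat.
  have cx : c * (4 / k%:R) <= (c - K) / 2 by rewrite mulrCA mulrA.
  have [eta1 key] := gap_const_slack K0 (ltW Kc) (ltW eta0) etaE x0 cx.
  move: (4 / k%:R) x1 W2 key => x x1 W2 key.
  apply: (@le_trans _ _ ((c * (1 - x) * (1 - eta)) * (L * Q%:R ^+ 2))).
    by rewrite -mulrA ler_wpM2r // mulr_ge0 ?sqr_ge0 // ltW.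
  have -> : c * (1 - x) * (1 - eta) * (L * Q%:R ^+ 2) =
            c * (Q%:R ^+ 2 * (1 - x)) * ((1 - eta) * L) by ring.
  apply: ler_pM => //.
  - by rewrite mulr_ge0 ?(ltW c0) // mulr_ge0 ?sqr_ge0 // subr_ge0.
  - by rewrite mulr_ge0 ?(ltW L0) // subr_ge0.
  - by rewrite ler_wpM2l // ltW.
have small_le := coprime_count_le_small_gaps (ltW c0) EQ Wle small.
rewrite gap_measure_itv ?(ltW c0) // lee_fin.
set C := #|_|; have CE : rho * E%:R ^+ 2 <= C%:R by apply: le_trans GQ _; rewrite ler_nat.
have N0R : 0 < (gap_number (A Q))%:R :> R by rewrite ltr0n.
rewrite ler_pdivrMr // -mulrA ler_pdivlMl //.
have rk0 : 0 <= rho / (2 * k%:R) ^+ 2 by rewrite divr_ge0 ?ltW.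
apply: le_trans (ler_wpM2r rk0 Nhi) _.
rewrite -[leLHS]mulrA [leRHS]mulrC ler_wpM2l ?(ltW KL0) //; apply: le_trans CE.
rewrite mulrA ler_pdivrMr // [leLHS]mulrC -[leRHS]mulrA ler_wpM2l ?(ltW rho0) //.
by rewrite -exprMn ler_sqr ?nnegrE ?mulr_ge0 // mulrC.
Unshelve. all: by end_near. Qed.

End neighbours.

(** * Passing to the weak limit *)

(** For [a < b], a continuous test function between the indicators of [[0, a]] and [[0, b]] on the
    half-line; the indicators themselves are not admissible in weak convergence. *)
Definition ramp (R : realType) (a b x : R) : R :=
  Num.max 0 (Num.min 1 ((b - x) / (b - a))).

Lemma ramp_continuous (R : realType) (a b : R) : continuous (ramp a b).
Proof.
apply: (@max_fun_continuous _ R R (fun=> 0)); first by move=> x; exact: cvg_cst.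
apply: (@min_fun_continuous _ R R (fun=> 1)); first by move=> x; exact: cvg_cst.
by move=> x; apply: cvgMl; apply: cvgB; [exact: cvg_cst|exact: cvg_id].
Qed.

Lemma ramp_ge0 (R : realType) (a b x : R) : 0 <= ramp a b x.
Proof. by rewrite le_max lexx. Qed.

Lemma ramp_le1 (R : realType) (a b x : R) : ramp a b x <= 1.
Proof. by rewrite ge_max ler01 ge_min lexx. Qed.

Lemma ramp_eq1 (R : realType) (a b x : R) : a < b -> x <= a -> ramp a b x = 1.
Proof.
move=> ab xa; rewrite /ramp (min_idPl _) ?(max_idPr _) //.
by rewrite ler_pdivlMr ?subr_gt0 // mul1r lerB.
Qed.

Lemma ramp_eq0 (R : realType) (a b x : R) : a < b -> b <= x -> ramp a b x = 0.
Proof.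
move=> ab bx; apply/max_idPl; rewrite ge_min; apply/orP; right.
by rewrite pmulr_lle0 ?invr_gt0 ?subr_gt0 // subr_le0.
Qed.

Lemma integral_ramp_bounds (R : realType) (mu : {measure set (measurableTypeR R) -> \bar R})
    (a b : R) : a < b ->
  (mu `[0%R, a]%classic <= \int[mu]_(x in `[0%R, +oo[%classic) (ramp a b x)%:E /\
   \int[mu]_(x in `[0%R, +oo[%classic) (ramp a b x)%:E <= mu `[0%R, b]%classic)%E.
Proof.
move=> ab.
have mD : measurable (`[0%R, +oo[%classic : set R) by exact: measurable_itv.
have mr : measurable_fun (`[0%R, +oo[%classic : set R)
    (EFin \o (ramp a b : R -> R)).
  apply/measurable_EFinP; apply: measurable_funTS.
  by apply: continuous_measurable_fun; exact: ramp_continuous.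
have itvI c : `[0%R, c]%classic `&` `[0%R, +oo[%classic = `[0%R, c]%classic :> set R.
  by apply/setIidPl => x /=; rewrite !in_itv /= => /andP[-> _].
have int_itv c : mu `[0%R, c]%classic =
    (\int[mu]_(x in `[0%R, +oo[%classic) (\1_(`[0%R, c]%classic : set R) x)%:E)%E.
  by rewrite integral_indic ?itvI //; exact: measurable_itv.
have mi c : measurable_fun (`[0%R, +oo[%classic : set R)
    (EFin \o (\1_(`[0%R, c]%classic) : R -> R)).
  apply/measurable_EFinP; apply: measurable_indic; exact: measurable_itv.
rewrite !int_itv; split.
  apply: (@ge0_le_integral _ (measurableTypeR R) R mu _ mD _ _ _ (mi a) mr) => x.
    by move=> _; rewrite lee_fin indicE; case: (_ \in _).
  move=> _; rewrite lee_fin indicE; case: (boolP (_ \in _)) => [|_]; last exact: ramp_ge0.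
  by rewrite inE /= in_itv /= => /andP[_ xa]; rewrite ramp_eq1.
apply: (@ge0_le_integral _ (measurableTypeR R) R mu _ mD _ _ _ mr (mi b)) => x.
  by move=> _; rewrite lee_fin ramp_ge0.
rewrite /= in_itv /= andbT => x0; rewrite lee_fin indicE.
case: (boolP (_ \in _)) => [_|]; first exact: ramp_le1.
rewrite notin_setE /= in_itv /= x0 /= => /negP; rewrite -ltNge => bx.
by rewrite ramp_eq0 // ltW.
Qed.

Lemma limiting_gap_measure_ramp (R : realType) (A : nat -> set R)
    (nu : probability (measurableTypeR R) R) (a b : R) :
  is_limiting_gap_measure A nu ->
  (\int[gap_measure (A n)]_(x in `[0%R, +oo[%classic) (ramp a b x)%:E)%E @[n --> \oo] -->
  (\int[nu]_(x in `[0%R, +oo[%classic) (ramp a b x)%:E)%E.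
Proof.
move=> [_]; apply; first by apply: continuous_subspaceT; exact: ramp_continuous.
by exists 1 => x _; rewrite ger0_norm ?ramp_ge0 ?ramp_le1.
Qed.

(** Passing through the ramp shrinks the interval from [b] to [a], which is harmless since a
    supremum is to be found. *)
Lemma limiting_gap_measure_eq0 (R : realType) (A : nat -> set R)
    (nu : probability (measurableTypeR R) R) (a b : R) : a < b ->
  is_limiting_gap_measure A nu ->
  (\forall n \near \oo, gap_measure (A n) `[0%R, b]%classic = 0%E) ->
  nu `[0%R, a]%classic = 0%E.
Proof.
move=> ab lim H; apply/eqP; rewrite eq_le measure_ge0 andbT.
have [h1 _] := integral_ramp_bounds nu ab; apply: le_trans h1 _.
have L := @limiting_gap_measure_ramp R A nu a b lim; rewrite -(cvg_lim _ L) //.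
apply: lime_le; first by apply: cvgP L.
apply: filterS H => n E; have [_ h2] := integral_ramp_bounds (gap_measure (A n)) ab.
by rewrite -E.
Qed.

Lemma limiting_gap_measure_ge (R : realType) (A : nat -> set R)
    (nu : probability (measurableTypeR R) R) (a b : R) (rho : \bar R) : a < b ->
  is_limiting_gap_measure A nu ->
  (\forall n \near \oo, (rho <= gap_measure (A n) `[0%R, a]%classic)%E) ->
  (rho <= nu `[0%R, b]%classic)%E.
Proof.
move=> ab lim H; have [_ h1] := integral_ramp_bounds nu ab; apply: le_trans h1.
have L := @limiting_gap_measure_ramp R A nu a b lim; rewrite -(cvg_lim _ L) //.
apply: lime_ge; first by apply: cvgP L.
apply: filterS H => n E; have [h2 _] := integral_ramp_bounds (gap_measure (A n)) ab.
exact: le_trans h2.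
Qed.

(** * The end points of the interval and the conclusion *)

Lemma interval_end_points (R : realType) (I : set R) :
  is_interval I -> I `<=` `[0, 1] -> (0 < lebesgue_measure I)%E ->
  exists alpha beta : R, [/\ 0 <= alpha, alpha < beta, beta <= 1,
    forall x, I x -> alpha <= x <= beta & forall x, alpha < x < beta -> I x].
Proof.
move=> itvI I01 Ipos.
have Ib x : I x -> 0 <= x <= 1 by move=> /I01; rewrite /= in_itv.
have lb : has_lbound I by exists 0 => x /Ib /andP[].
have ub : has_ubound I by exists 1 => x /Ib /andP[].
have I0 : I !=set0.
  by apply/set0P; apply: contraTneq Ipos => ->; rewrite measure0 ltxx.
have Isub x : I x -> inf I <= x <= sup I.
  by move=> Ix; rewrite ge_inf //= ub_le_sup.
exists (inf I), (sup I); split => //.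
- by apply: lb_le_inf => // x /Ib /andP[].
(* Otherwise the interval lies in a single point and has measure zero. *)
- rewrite ltNge; apply/negP => si.
  have sub1 : I `<=` [set inf I].
    by move=> x /Isub /andP[h1 h2]; apply/eqP; rewrite eq_le h1 (le_trans h2).
  have : (lebesgue_measure I <= lebesgue_measure [set inf I])%E.
    by apply: le_measure => //; rewrite inE; [exact: is_interval_measurable|exact: measurable_set1].
  by rewrite lebesgue_measure_set1 leNgt Ipos.
- by apply: ge_sup => // x /Ib /andP[].
- move=> x xI; apply: interior_subset; rewrite interval_bounded_interior //.
Qed.

Theorem mainTheorem5 (R : realType) (I : set R) (m : nat)
    (I_interval : is_interval I) (I_sub : I `<=` `[0, 1]%classic)
    (I_length : (0 < lebesgue_measure I)%E) (m_gt0 : (0 < m)%N)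
    (nu : probability (measurableTypeR R) R)
    (nu_limit : is_limiting_gap_measure (farey_mod1 I m) nu) :
  repulsion_gap nu =
  3 / (pi ^+ 2 * m%:R * \prod_(p <- primes m) (1 - (p%:R ^+ 2)^-1)).
Proof.
rewrite -/(repulsion_const R m).
have [alpha [beta [a0 ab b1 Isub subI]]] := interval_end_points I_interval I_sub I_length.
have K0 := @repulsion_const_gt0 R m m_gt0.
(* Below and above the constant alike, the midpoint between it and [c] leaves room for the ramp. *)
have below c : 0 <= c < repulsion_const R m -> nu `[0%R, c]%classic = 0%E.
  move=> /andP[c0 cK]; have [h1 h2] := midf_lt cK.
  apply: (limiting_gap_measure_eq0 h1 nu_limit).
  apply: (near_gap_measure_eq0 a0 ab b1 m_gt0 Isub subI).
  by rewrite h2 andbT (le_trans c0) // ltW.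
have above c : repulsion_const R m < c -> (0 < nu `[0%R, c]%classic)%E.
  move=> Kc; have [h1 h2] := midf_lt Kc.
  have [rho rho0 H] := near_gap_measure_ge a0 ab b1 m_gt0 Isub subI h1.
  by have := limiting_gap_measure_ge h2 nu_limit H; apply: lt_le_trans; rewrite lte_fin.
have ubK : ubound [set c : R | 0 <= c /\ nu `[0, c]%classic = 0%E] (repulsion_const R m).
  move=> c [_ nc]; rewrite leNgt; apply/negP => /above.
  by rewrite nc ltxx.
set S := [set c : R | _] in ubK *.
have S0 : S 0 by split => //; apply: below; rewrite lexx.
have supS c : S c -> c <= sup S by apply: ub_le_sup; exists (repulsion_const R m).
apply/eqP; rewrite eq_le; apply/andP; split; first by apply: ge_sup => //; exists 0.
(* If the supremum were smaller than the constant, their midpoint would belong to [S] by [below]. *)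
rewrite leNgt; apply/negP => /midf_lt [h1 h2].
have c0 := le_trans (supS _ S0) (ltW h1).
by have := supS _ (conj c0 (below _ (introT andP (conj c0 h2)))); rewrite leNgt h1.
Qed.
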